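(* Let $f(x)=\frac12 x^TQx+p^Tx+r$ be a quadratic function on $\mathbb{R}^d$ with $Q$ symmetric positive definite, with smallest eigenvalue $\mu$ and largest eigenvalue $L$, $0<\mu<L$, and let $\kappa=L/\mu$. Define $$a(\kappa)=\begin{cases}\frac{\sqrt\kappa(\sqrt{2\kappa-1}-1)}{\kappa-1} & \text{if }\kappa\ge32,\\ 1 & \text{otherwise.}\end{cases}$$ Consider the heavy-ball method (GMM with $\nu=0$) with parameters $\alpha=\frac{a^2(\kappa)}{L}$, $\nu=0$ and $\beta=\Big(1-\frac{a(\kappa)}{\sqrt\kappa}\Big)^2$ for minimizing $f$. Then this method admits the rate $\rho=\rho(A_Q)=1-\frac{a(\kappa)}{\sqrt\kappa}$ and the best robustness level $L_{2,*}=H_\infty=\frac{1}{\sqrt{2\mu}}$. Here $a(\kappa)$ is a non-decreasing function of $\kappa$ with $a(\kappa)>\frac54$ for $\kappa\ge32$ and $a(\kappa)=\sqrt2-\frac{1}{\sqrt\kappa}+\mathcal{O}(\frac1\kappa)$ as $\kappa\to\infty$. Therefore $\rho=1-\frac{\sqrt2}{\sqrt\kappa}+\mathcal{O}(\frac1\kappa)$ as $\kappa\to\infty$.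
   Context: Generalized momentum method (GMM) with gradient errors $w_k\in\mathbb{R}^d$ and parameters $(\alpha,\beta,\nu)$: starting from $x_0=x_{-1}\in\mathbb{R}^d$, $$x_{k+1}=x_k-\alpha(\nabla f(y_k)+w_k)+\beta(x_k-x_{k-1}),\qquad y_k=x_k+\nu(x_k-x_{k-1}),\quad k\ge 0.$$ Let $x_*$ be the minimizer of $f$. $\ell_2$ gain (worst-case robustness): $L_{2,*}$ is the infimum of all $\gamma>0$ for which there is a function $\overline H:\mathbb{R}^d\to[0,\infty)$, independent of the error sequence, with $\overline H(x_* )=0$, such that for every initialization $x_0=x_{-1}\in\mathbb{R}^d$ and every square-summable $\{w_k\}_{k\ge0}\subset\mathbb{R}^d$, $$\sum_{k\ge0}(f(x_k)-f(x_* ))\le\gamma^2\sum_{k\ge0}\|w_k\|^2+\overline H(x_0).$$ Matrices: with $Q=U\Lambda U^T$ an orthogonal eigendecomposition (eigenvalues in increasing order), $$A_Q=\begin{bmatrix}(1+\beta)I_d-\alpha(1+\nu)Q & -\beta I_d+\alpha\nu Q\\ I_d & 0_d\end{bmatrix},\quad B=\begin{bmatrix}-\alpha I_d\\0_d\end{bmatrix},\quad T=\begin{bmatrix}\tfrac{1}{\sqrt2}\Lambda^{1/2}U^T & 0_d\end{bmatrix}.$$ $\rho(\cdot)$ is the spectral radius and $\|\cdot\|$ the spectral norm; the (errorless) convergence rate of GMM on the quadratic $f$ is $\rho(A_Q)$. The $H_\infty$ norm (for $\rho(A_Q)<1$) is $H_\infty:=\max_{z\in\mathbb{C},|z|=1}\|G(z)\|$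 with $G(z):=T(zI-A_Q)^{-1}B$. ''Best robustness level'' refers to the value $\frac1{\sqrt{2\mu}}$, which is the smallest possible value of $L_{2,*}$ over all GMM parameters with $\rho(A_Q)<1$. *)

(* Defs.v *)
From HB Require Import structures.
From mathcomp Require Import all_boot all_order all_algebra.
From mathcomp Require Import complex.
From mathcomp Require Import all_classical all_reals all_analysis.

Set Implicit Arguments.
Unset Strict Implicit.
Unset Printing Implicit Defensive.

Import Order.TTheory GRing.Theory Num.Theory.
Import numFieldNormedType.Exports.
Export numFieldNormedType.Exports.

Local Open Scope classical_set_scope.
Local Open Scope ring_scope.

(** The library norm on matrices is the sup norm, hence these explicit
    Euclidean norms. *)

Definition sqnorm2 (R : realType) (d : nat) (v : 'cV[R]_d) : R :=
  \sum_(i < d) v i 0 ^+ 2.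

Definition cnorm2 (R : realType) (n : nat) (v : 'cV[R[i]]_n) : R :=
  Num.sqrt (\sum_(i < n) ComplexField.Normc.normc (v i 0) ^+ 2).

Definition spectral_norm (R : realType) (m n : nat) (M : 'M[R[i]]_(m, n)) : R :=
  sup [set cnorm2 (M *m v) | v in [set v : 'cV[R[i]]_n | cnorm2 v <= 1]].

Definition complexmx (R : realType) (m n : nat) (M : 'M[R]_(m, n)) :
  'M[R[i]]_(m, n) := map_mx (real_complex R) M.

(** The supremum ranges over a finite set (nonempty for n > 0), so it is the
    largest modulus of a complex eigenvalue. *)
Definition spectral_radius (R : realType) (n : nat) (M : 'M[R]_n) : R :=
  sup [set ComplexField.Normc.normc z |
        z in [set z : R[i] | eigenvalue (complexmx M) z]].

Definition quadratic (R : realType) (d : nat) (Q : 'M[R]_d) (p : 'cV[R]_d)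
    (r : R) (x : 'cV[R]_d) : R :=
  2^-1 * (x^T *m Q *m x) 0 0 + (p^T *m x) 0 0 + r.

Definition sym_posdef (R : realType) (d : nat) (Q : 'M[R]_d) : Prop :=
  Q^T = Q /\ forall x : 'cV[R]_d, x != 0 -> 0 < (x^T *m Q *m x) 0 0.

Definition smallest_eigenvalue (R : realType) (d : nat) (Q : 'M[R]_d) (mu : R) :
  Prop := eigenvalue Q mu /\ forall e, eigenvalue Q e -> mu <= e.

Definition largest_eigenvalue (R : realType) (d : nat) (Q : 'M[R]_d) (L : R) :
  Prop := eigenvalue Q L /\ forall e, eigenvalue Q e -> e <= L.

Definition orthogonal_eigendecomposition (R : realType) (d : nat)
    (Q U : 'M[R]_d) (lam : 'rV[R]_d) : Prop :=
  [/\ U *m U^T = 1%:M,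
      Q = U *m diag_mx lam *m U^T &
      forall i j : 'I_d, (i <= j)%N -> lam 0 i <= lam 0 j].

Definition minimizer (R : realType) (d : nat) (f : 'cV[R]_d -> R)
    (xs : 'cV[R]_d) : Prop := forall x, f xs <= f x.

Definition gradient (R : realType) (d : nat) (f : 'cV[R]_d -> R)
    (x : 'cV[R]_d) : 'cV[R]_d :=
  \col_(i < d) 'D_(delta_mx i 0) (f : 'cV[R]_d -> R^o) x.

(** [gmm_state ... k] is the pair (x_k, x_{k-1}), with x_{-1} = x_0. *)
Fixpoint gmm_state (R : realType) (d : nat) (alpha beta nu : R)
    (f : 'cV[R]_d -> R) (w : nat -> 'cV[R]_d) (x0 : 'cV[R]_d) (k : nat) :
    'cV[R]_d * 'cV[R]_d :=
  if k is k'.+1 then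
    let: (x, xprev) := gmm_state alpha beta nu f w x0 k' in
    let y := x + nu *: (x - xprev) in
    (x - alpha *: (gradient f y + w k') + beta *: (x - xprev), x)
  else (x0, x0).

Definition gmm (R : realType) (d : nat) (alpha beta nu : R)
    (f : 'cV[R]_d -> R) (w : nat -> 'cV[R]_d) (x0 : 'cV[R]_d) (k : nat) :
    'cV[R]_d := (gmm_state alpha beta nu f w x0 k).1.

Definition square_summable (R : realType) (d : nat) (w : nat -> 'cV[R]_d) :
  Prop := (\sum_(0 <= k <oo) (sqnorm2 (w k))%:E < +oo)%E.

(** The inequality is in the extended reals, as the series of suboptimalities
    may diverge. *)
Definition admissible_gain (R : realType) (d : nat) (alpha beta nu : R)
    (f : 'cV[R]_d -> R) (xs : 'cV[R]_d) (gamma : R) : Prop :=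
  exists H : 'cV[R]_d -> R,
    [/\ forall x, 0 <= H x,
        H xs = 0 &
        forall (x0 : 'cV[R]_d) (w : nat -> 'cV[R]_d), square_summable w ->
          (\sum_(0 <= k <oo) (f (gmm alpha beta nu f w x0 k) - f xs)%:E <=
           (gamma ^+ 2)%:E * (\sum_(0 <= k <oo) (sqnorm2 (w k))%:E)
             + (H x0)%:E)%E].

(** Equal to +oo if no gain is admissible. *)
Definition l2_gain (R : realType) (d : nat) (alpha beta nu : R)
    (f : 'cV[R]_d -> R) (xs : 'cV[R]_d) : \bar R :=
  ereal_inf [set gamma%:E | gamma in
    [set gamma : R | 0 < gamma /\ admissible_gain alpha beta nu f xs gamma]].

Definition A_mx (R : realType) (d : nat) (Q : 'M[R]_d) (alpha beta nu : R) :
    'M[R]_(d + d) :=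
  block_mx ((1 + beta)%:M - (alpha * (1 + nu)) *: Q)
           (- beta%:M + (alpha * nu) *: Q)
           1%:M 0.

Definition B_mx (R : realType) (d : nat) (alpha : R) : 'M[R]_(d + d, d) :=
  col_mx (- alpha%:M) 0.

Definition T_mx (R : realType) (d : nat) (U : 'M[R]_d) (lam : 'rV[R]_d) :
    'M[R]_(d, d + d) :=
  row_mx ((Num.sqrt 2)^-1 *: (diag_mx (map_mx Num.sqrt lam) *m U^T)) 0.

Definition transfer_mx (R : realType) (d : nat) (Q U : 'M[R]_d)
    (lam : 'rV[R]_d) (alpha beta nu : R) (z : R[i]) : 'M[R[i]]_d :=
  complexmx (T_mx U lam)
    *m invmx (z%:M - complexmx (A_mx Q alpha beta nu))
    *m complexmx (B_mx d alpha).

(** The supremum is a maximum when the spectral radius of A is below 1. *)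
Definition hinf_norm (R : realType) (d : nat) (Q U : 'M[R]_d)
    (lam : 'rV[R]_d) (alpha beta nu : R) : R :=
  sup [set spectral_norm (transfer_mx Q U lam alpha beta nu z) |
        z in [set z : R[i] | ComplexField.Normc.normc z = 1]].

Definition hb_a (R : realType) (kappa : R) : R :=
  if 32 <= kappa then
    Num.sqrt kappa * (Num.sqrt (2 * kappa - 1) - 1) / (kappa - 1)
  else 1.

Definition hb_alpha (R : realType) (mu L : R) : R := hb_a (L / mu) ^+ 2 / L.

Definition hb_beta (R : realType) (mu L : R) : R :=
  (1 - hb_a (L / mu) / Num.sqrt (L / mu)) ^+ 2.

(* Main.v *)
Require Import Defs.
From HB Require Import structures.
From mathcomp Require Import all_boot all_order all_algebra.
From mathcomp Require Import complex.
From mathcomp Require Import all_classical all_reals all_analysis.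
From mathcomp Require Import ring lra zify.
Import Order.TTheory GRing.Theory Num.Theory.
Import numFieldNormedType.Exports.
Import ComplexField.Normc.
Local Open Scope classical_set_scope.
Local Open Scope ring_scope.

Set Implicit Arguments.
Unset Strict Implicit.
Unset Printing Implicit Defensive.

(** In an orthonormal eigenbasis of [Q], centred at the minimizer, the method
    splits into scalar recursions, one per eigenvalue [lam]. With
    [b = 1 - a / sqrt kappa], so that [beta = b ^ 2], the heavy-ball recursion is
      [x_(k+1) - c x_k + b ^ 2 x_(k-1) = - alpha w_k],
      [c = 1 + b ^ 2 - alpha lam].
    The step size is tuned so that [alpha mu = (1 - b) ^ 2], i.e. [c = 2 b] at
    [lam = mu], and so that [alpha L = a ^ 2 <= 1 + b ^ 2], i.e. [c >= 0] for
    every eigenvalue ([hb_a_bounds]; for [kappa >= 32] the formula for [a] is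
    the positive solution of [a ^ 2 = 1 + b ^ 2]). So [0 <= c <= 2 b]
    throughout, and everything follows from that.

    Rate: the eigenvalues of the iteration matrix are the roots of
    [z ^ 2 - c z + b ^ 2] for real [c] with [c ^ 2 <= 4 b ^ 2]; all have
    modulus exactly [b].

    Gain at most [1 / sqrt (2 mu)]: there is a nonnegative quadratic form
    [storage] on pairs of consecutive iterates whose increase along one step is
    at most [(alpha w_k) ^ 2 - alpha ^ 2 lam mu x_k ^ 2]
    ([storage_dissipation]). Summing over time and eigenvalues bounds the total
    suboptimality by the energy of the errors divided by [2 mu], plus the
    initial storage; this is the l2 bound ([heavy_ball_admissible]). Evaluating
    the same inequality on the rotating sequence [z ^ k] with [|z| = 1], along
    which the total storage of the real and imaginary parts is constant, gives
    the pointwise bound on the transfer function ([frequency_bound]), hence the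
    [H_infinity] bound. The value is attained at [z = 1] in the eigenspace of
    [mu].

    Gain at least [1 / sqrt (2 mu)], for every choice of parameters with a
    stable iteration: stability forces [alpha <> 0], hence any trajectory can be
    prescribed and the errors solved for. Displacing the iterate from the
    minimizer by an eigenvector [v] of [mu] during [n] steps costs errors of
    energy [(mu ^ 2 n + O(1)) |v| ^ 2] and produces the suboptimality
    [(mu / 2) n |v| ^ 2] ([gain_lower_bound]).

    The assertions on [a] come from its closed form: with [k = sqrt kappa] and
    [m = sqrt (2 kappa - 1)], [a = 2 k / (m + 1)]. *)

(** * Matrix entries, complex moduli, real and imaginary parts *)

Section MatrixEntries.
Variables (V : pzRingType) (m n : nat).
Implicit Types (A B : 'M[V]_(m, n)).

Lemma addmxE A B i j : (A + B) i j = A i j + B i j. Proof. by rewrite mxE. Qed.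

Lemma oppmxE A i j : (- A) i j = - A i j. Proof. by rewrite mxE. Qed.

Lemma scalemxE c A i j : (c *: A) i j = c * A i j. Proof. by rewrite mxE. Qed.
End MatrixEntries.

Lemma normc_ge0 (R : realType) (z : R[i]) : 0 <= normc z.
Proof. by case: z => x y; exact: sqrtr_ge0. Qed.

Lemma normc_real (R : realType) (x : R) : normc (real_complex R x) = `|x|.
Proof. by rewrite /normc /= expr0n addr0 sqrtr_sqr. Qed.

Lemma normc_sqr (R : realType) (x y : R) : normc (Complex x y) ^+ 2 = x ^+ 2 + y ^+ 2.
Proof. by rewrite /normc sqr_sqrtr// addr_ge0 ?sqr_ge0. Qed.

Section RealImaginaryParts.
Variable R : realType.

Lemma ReD (x y : R[i]) : complex.Re (x + y) = complex.Re x + complex.Re y.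
Proof. by case: x y => ? ? []. Qed.

Lemma ImD (x y : R[i]) : complex.Im (x + y) = complex.Im x + complex.Im y.
Proof. by case: x y => ? ? []. Qed.

Lemma Re_mulmx (m n p : nat) (A : 'M[R[i]]_(m, n)) (M : 'M[R]_(n, p)) :
  map_mx (@complex.Re R) (A *m complexmx M) = map_mx (@complex.Re R) A *m M.
Proof.
apply/matrixP => i j; rewrite !mxE (big_morph (@complex.Re R) ReD (erefl _)).
apply: eq_bigr => k _; rewrite !mxE.
by case: (A i k) => x y /=; rewrite mulr0 subr0.
Qed.

Lemma Im_mulmx (m n p : nat) (A : 'M[R[i]]_(m, n)) (M : 'M[R]_(n, p)) :
  map_mx (@complex.Im R) (A *m complexmx M) = map_mx (@complex.Im R) A *m M.
Proof.
apply/matrixP => i j; rewrite !mxE (big_morph (@complex.Im R) ImD (erefl _)).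
apply: eq_bigr => k _; rewrite !mxE.
by case: (A i k) => x y /=; rewrite mulr0 add0r.
Qed.
End RealImaginaryParts.

(** * A storage function for the scalar heavy-ball recursion *)

Section Storage.
Variables (R : realFieldType) (b c : R).

(** A storage function for [x_(k+1) = c x_k - b ^ 2 x_(k-1) + error], evaluated
    at [x = x_k], [y = x_(k-1)]. Its coefficients are forced by requiring that
    the dissipation inequality hold up to a sum of squares. On the unit circle,
    with [u] the real part of [z], the quantity to be kept nonnegative is a
    quadratic polynomial in [u] with leading coefficient [4 b ^ 2] and vertex
    at [(1 + b ^ 2) c / (4 b ^ 2)]. When the vertex lies in [[0, 1]] (first
    branch) one completes the square there; otherwise (second branch) one
    expands around [u = 1], where [1 - u = |1 - z| ^ 2 / 2] turns into first
    and second differences of the sequence. *)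
Definition storage (x y : R) : R :=
  if (1 + b ^+ 2) * c <= 4 * b ^+ 2 then
    (1 - b ^+ 2) * (x ^+ 2 - c * x * y + b ^+ 2 * y ^+ 2)
  else
    (1 - b ^+ 2) * x ^+ 2 + 2 * (2 * b ^+ 2 - c) * x * y
      + (b ^+ 2 - b ^+ 4 + ((1 + b ^+ 2) * c - 4 * b ^+ 2)) * y ^+ 2.

Lemma storage00 : storage 0 0 = 0.
Proof. by rewrite /storage; case: ifP => _; ring. Qed.

(** For [z = u + i s] on the unit circle, the storages at [(z ^ (k+1), z ^ k)],
    summed over real and imaginary parts, do not depend on [k]: a real
    quadratic form extends to a Hermitian form, which ignores the common phase.
    The case stated compares [k = 0] with [k = - 1]. *)
Lemma storage_rotation u s : u ^+ 2 + s ^+ 2 = 1 ->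
  storage u 1 + storage s 0 = storage 1 u + storage 0 (- s).
Proof.
move=> us; have s2 : s ^+ 2 = 1 - u ^+ 2 by rewrite -us; ring.
by rewrite /storage; case: ifP => _; ring: s2.
Qed.

(** In the first branch this is [c ^ 2 <= 4 b ^ 2]. In the second branch one
    needs the determinant of the form, whose sign is visible in the variable
    [k = (1 + b ^ 2) c - 4 b ^ 2], the excess over the branching threshold,
    which ranges over [[0, 2 b (1 - b) ^ 2]]. *)
Lemma storage_ge0 x y : 0 < b -> b < 1 -> 0 <= c -> c <= 2 * b ->
  0 <= storage x y.
Proof.
move=> b_gt0 b_lt1 c_ge0 c_le.
have p_gt0 : 0 < 1 - b ^+ 2.
  have -> : 1 - b ^+ 2 = (1 - b) * (1 + b) by ring.
  by rewrite mulr_gt0//; lra.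
rewrite /storage; case: ifP => hc.
  apply: mulr_ge0; first exact: ltW.
  have -> : x ^+ 2 - c * x * y + b ^+ 2 * y ^+ 2
    = (x - c / 2 * y) ^+ 2 + (2 * b - c) * (2 * b + c) / 4 * y ^+ 2 by field.
  rewrite addr_ge0 ?sqr_ge0// mulr_ge0 ?sqr_ge0// divr_ge0// mulr_ge0//; lra.
set r := (X in _ + X * y ^+ 2).
set q := 2 * b ^+ 2 - c.
suff det_ge0 : 0 <= (1 - b ^+ 2) * r - q ^+ 2.
  rewrite -(pmulr_rge0 _ p_gt0).
  have -> : (1 - b ^+ 2) * ((1 - b ^+ 2) * x ^+ 2 + 2 * q * x * y + r * y ^+ 2)
    = ((1 - b ^+ 2) * x + q * y) ^+ 2 + ((1 - b ^+ 2) * r - q ^+ 2) * y ^+ 2 by ring.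
  by rewrite addr_ge0 ?sqr_ge0// mulr_ge0 ?sqr_ge0.
pose k := (1 + b ^+ 2) * c - 4 * b ^+ 2.
have k_ge0 : 0 <= k by rewrite subr_ge0; apply/ltW; rewrite ltNge hc.
have k_le : k <= 2 * b * (1 - b) ^+ 2.
  have D_ge0 : 0 <= 1 + b ^+ 2 by rewrite addr_ge0 ?sqr_ge0.
  by have := ler_wpM2l D_ge0 c_le; rewrite /k; lra.
have D_gt0 : 0 < (1 + b ^+ 2) ^+ 2 by rewrite exprn_gt0// ltr_wpDr ?sqr_ge0.
rewrite -(pmulr_rge0 _ D_gt0).
have -> : (1 + b ^+ 2) ^+ 2 * ((1 - b ^+ 2) * r - q ^+ 2)
  = (2 * b * (1 - b) ^+ 2 - k) * (b * (1 - b) ^+ 2 * (1 + b) ^+ 4 / 2 + k)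
    + k * (1 - b) ^+ 2 *
      (b * (1 + b) ^+ 4 / 2 + (1 - b) * (1 + b) ^+ 3 - 2 * b).
  by rewrite /r /q /k; field.
have b1_ge0 : 0 <= 1 - b by lra.
have b2_ge0 : 0 <= 1 + b by lra.
apply: addr_ge0; apply: mulr_ge0.
- lra.
- by rewrite addr_ge0// divr_ge0// !mulr_ge0 ?exprn_ge0 ?(ltW b_gt0).
- by rewrite mulr_ge0// exprn_ge0.
- have -> : b * (1 + b) ^+ 4 / 2 + (1 - b) * (1 + b) ^+ 3 - 2 * b
    = ((1 + b) ^+ 3 * (b ^+ 2 - b + 2) - 4 * b) / 2 by field.
  apply: divr_ge0 => //.
  have h3 : 1 + 3 * b <= (1 + b) ^+ 3.
    have -> : (1 + b) ^+ 3 = 1 + 3 * b + b ^+ 2 * (3 + b) by ring.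
    by rewrite lerDl mulr_ge0 ?sqr_ge0//; lra.
  have h2 : 7 / 4 <= b ^+ 2 - b + 2.
    have -> : b ^+ 2 - b + 2 = (b - 1 / 2) ^+ 2 + 7 / 4 by field.
    by rewrite lerDr sqr_ge0.
  (* [7 / 4] is the minimum of [b ^ 2 - b + 2], and
     [(7 / 4) (1 + 3 b) >= 4 b]. *)
  have := ler_pM _ _ h3 h2; lra.
Qed.

(** The right side is the squared error [(alpha w) ^ 2], and for
    [c = 1 + b ^ 2 - alpha lam], [alpha mu = (1 - b) ^ 2] the coefficient of
    [x1 ^ 2] is [alpha ^ 2 lam mu]. The defect is an explicit sum of squares in
    each branch of [storage]. *)
Lemma storage_dissipation x2 x1 x0 : 0 < b -> 0 <= c -> c <= 2 * b ->
  storage x2 x1 - storage x1 x0 + (1 + b ^+ 2 - c) * (1 - b) ^+ 2 * x1 ^+ 2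
    <= (x2 - c * x1 + b ^+ 2 * x0) ^+ 2.
Proof.
move=> b_gt0 c_ge0 c_le.
rewrite -subr_ge0 /storage; case: ifP => hc.
  (* [b x2 - e x1 + b x0] is the spectral factor obtained by completing the
     square at the vertex; [rest] is the value at the vertex. *)
  pose e := (1 + b ^+ 2) * c / (2 * b).
  pose rest := (1 - b) ^+ 2 * (4 * b ^+ 2 * (c + 2 * b) - (1 + b) ^+ 2 * c ^+ 2)
    / (4 * b ^+ 2).
  rewrite (_ : _ - _ = (b * x2 - e * x1 + b * x0) ^+ 2 + rest * x1 ^+ 2); last first.
    rewrite /e /rest; field; exact: lt0r_neq0.
  rewrite addr_ge0 ?sqr_ge0// mulr_ge0 ?sqr_ge0//.
  apply: divr_ge0; last by rewrite mulr_ge0 ?sqr_ge0.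
  apply: mulr_ge0; first exact: sqr_ge0.
  rewrite subr_ge0.
  have D_gt0 : 0 < 1 + b ^+ 2 by rewrite ltr_wpDr ?sqr_ge0.
  have hb : 0 <= 1 + b ^+ 2 - c by have := sqr_ge0 (1 - b); lra.
  rewrite -(ler_pM2l D_gt0).
  (* [rest >= 0] amounts to [(1 + b) ^ 2 c ^ 2 <= 4 b ^ 2 (c + 2 b)]: one factor
     [c] is traded for [4 b ^ 2 / (1 + b ^ 2)] by the branch condition. *)
  have h1 : (1 + b) ^+ 2 * c * ((1 + b ^+ 2) * c) <= (1 + b) ^+ 2 * c * (4 * b ^+ 2).
    by rewrite ler_wpM2l// mulr_ge0 ?sqr_ge0.
  have h2 : 0 <= 8 * b ^+ 3 * (1 + b ^+ 2 - c).
    by rewrite !mulr_ge0 ?exprn_ge0 ?(ltW b_gt0).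
  rewrite -subr_ge0.
  have -> : (1 + b ^+ 2) * (4 * b ^+ 2 * (c + 2 * b)) -
    (1 + b ^+ 2) * ((1 + b) ^+ 2 * c ^+ 2)
    = ((1 + b) ^+ 2 * c * (4 * b ^+ 2) - (1 + b) ^+ 2 * c * ((1 + b ^+ 2) * c))
      + 8 * b ^+ 3 * (1 + b ^+ 2 - c) by ring.
  by rewrite addr_ge0// subr_ge0.
rewrite (_ : _ - _ = (2 * b - c) * (1 + b ^+ 2 - c) * x1 ^+ 2
  + ((1 + b ^+ 2) * c - 4 * b ^+ 2) * (x1 - x0) ^+ 2
  + b ^+ 2 * (x2 - 2 * x1 + x0) ^+ 2); last by ring.
have h1 : c <= 1 + b ^+ 2 by have := sqr_ge0 (1 - b); lra.
have h2 : 4 * b ^+ 2 <= (1 + b ^+ 2) * c by apply/ltW; rewrite ltNge hc.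
by apply: addr_ge0; [apply: addr_ge0|]; apply: mulr_ge0; rewrite ?sqr_ge0//;
  [apply: mulr_ge0|]; rewrite subr_ge0.
Qed.

(** The dissipation inequality along [1 / z, 1, z], for the real and the
    imaginary part; adding the two cancels the storage. The right side is
    [|z - c + b ^ 2 / z| ^ 2] for [z = u + i s]. *)
Lemma frequency_bound u s : 0 < b -> 0 <= c -> c <= 2 * b ->
  u ^+ 2 + s ^+ 2 = 1 ->
  (1 + b ^+ 2 - c) * (1 - b) ^+ 2
    <= (u - c + b ^+ 2 * u) ^+ 2 + (s - b ^+ 2 * s) ^+ 2.
Proof.
move=> b_gt0 c_ge0 c_le us.
have hu := storage_dissipation u 1 u b_gt0 c_ge0 c_le.
have hs := storage_dissipation s 0 (- s) b_gt0 c_ge0 c_le.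
by have := storage_rotation us; lra.
Qed.
End Storage.

(** * The coefficient [hb_a] *)

(** Multiplying by [m + 1], where [m = sqrt (2 kappa - 1)], uses
    [m ^ 2 - 1 = 2 (kappa - 1)] and removes the quotient by [kappa - 1]; all
    estimates on [hb_a] start from this form. *)
Lemma hb_a_largeE (R : realType) (kappa : R) : 32 <= kappa ->
  [/\ 5 < Num.sqrt kappa,
      1 <= Num.sqrt (2 * kappa - 1),
      Num.sqrt (2 * kappa - 1) ^+ 2 = 2 * Num.sqrt kappa ^+ 2 - 1 &
      hb_a kappa = 2 * Num.sqrt kappa / (Num.sqrt (2 * kappa - 1) + 1)].
Proof.
move=> k32.
have k5 : 5 < Num.sqrt kappa.
  rewrite -[5]ger0_norm// -sqrtr_sqr ltr_sqrt; lra.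
have m1 : 1 <= Num.sqrt (2 * kappa - 1).
  by rewrite -[X in X <= _]sqrtr1 ler_sqrt; lra.
have k2 : Num.sqrt kappa ^+ 2 = kappa by rewrite sqr_sqrtr; lra.
have m2 : Num.sqrt (2 * kappa - 1) ^+ 2 = 2 * kappa - 1 by rewrite sqr_sqrtr; lra.
split=> //; first by rewrite m2 k2.
rewrite /hb_a k32.
move: m1 m2; set m := Num.sqrt (_ - _) => m1 m2.
have -> : kappa = (m ^+ 2 + 1) / 2 by rewrite m2; field.
by field; rewrite !lt0r_neq0//; nra.
Qed.

(** The equation that singles out [a]: the factor is chosen as large as
    possible subject to [alpha L <= 1 + beta]. It follows from
    [1 - a / sqrt kappa = (m - 1) / (m + 1)]. *)
Lemma hb_a_large_sq (R : realType) (kappa : R) : 32 <= kappa ->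
  hb_a kappa ^+ 2 = 1 + (1 - hb_a kappa / Num.sqrt kappa) ^+ 2.
Proof.
move=> /hb_a_largeE[k5 m1 m2 ->].
have k2 : Num.sqrt kappa ^+ 2 = (Num.sqrt (2 * kappa - 1) ^+ 2 + 1) / 2.
  by rewrite m2; field.
move: k5 m1 k2; set m := Num.sqrt (_ - _); set k := Num.sqrt _ => k5 m1 k2.
have k0 : k != 0 by rewrite lt0r_neq0//; lra.
have m0 : m + 1 != 0 by rewrite lt0r_neq0//; lra.
have -> : 1 - 2 * k / (m + 1) / k = (m - 1) / (m + 1).
  by field; apply/andP; split.
rewrite !expr_div_n exprMn k2; field; exact: m0.
Qed.

(** These are the only properties of [a] behind the rate and the gain, and they
    cover both regimes of its definition. *)
Lemma hb_a_bounds (R : realType) (kappa : R) : 1 < kappa ->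
  [/\ 0 < hb_a kappa, hb_a kappa / Num.sqrt kappa < 1 &
      hb_a kappa ^+ 2 <= 1 + (1 - hb_a kappa / Num.sqrt kappa) ^+ 2].
Proof.
move=> k1; have [k32|k32] := leP 32 kappa.
  rewrite (hb_a_large_sq k32) lexx.
  have [k5 m1 _ ->] := hb_a_largeE k32.
  have k0 : 0 < Num.sqrt kappa by lra.
  have m0 : 0 < Num.sqrt (2 * kappa - 1) + 1 by lra.
  split=> //; first by rewrite divr_gt0// mulr_gt0.
  rewrite mulrAC mulfK ?lt0r_neq0// ltr_pdivrMr// mul1r.
  suff : 1 < Num.sqrt (2 * kappa - 1) by lra.
  by rewrite -[X in X < _]sqrtr1 ltr_sqrt; lra.
rewrite /hb_a leNgt k32 /=; split => //; last by rewrite expr1n lerDl sqr_ge0.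
have k0 : 1 < Num.sqrt kappa by rewrite -[X in X < _]sqrtr1 ltr_sqrt; lra.
rewrite ltr_pdivrMr; lra.
Qed.

(** After squaring, the claim for [k = sqrt kappa] is
    [7 k ^ 2 - 40 k + 25 > 0], whose roots are [5 / 7] and [5]; and
    [32 > 5 ^ 2]. *)
Lemma hb_a_gt (R : realType) (kappa : R) : 32 <= kappa -> 5 / 4 < hb_a kappa.
Proof.
move=> /hb_a_largeE[k5 m1 m2 ->].
move: k5 m1 m2; set m := Num.sqrt (_ - _); set k := Num.sqrt _ => k5 m1 m2.
rewrite ltr_pdivlMr; last by lra.
suff : 5 * m < 8 * k - 5 by lra.
rewrite -ltr_sqr ?nnegrE; [|lra|lra].
rewrite exprMn m2 -subr_gt0.
have -> : (8 * k - 5) ^+ 2 - 5 ^+ 2 * (2 * k ^+ 2 - 1)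
  = 2 * (k - 5) * (7 * k - 5) by ring.
by rewrite !mulr_gt0//; lra.
Qed.

(** The delicate case is [32 <= kappa1]: with [n = sqrt kappa],
    [m = sqrt (2 kappa - 1)], one needs [n1 m2 - n2 m1 <= n2 - n1], and the
    left side is [(n2 - n1) (n2 + n1) / (n1 m2 + n2 m1)] with [m1, m2 >= 1]. *)
Lemma hb_a_nondecreasing (R : realType) (kappa1 kappa2 : R) :
  1 < kappa1 -> kappa1 <= kappa2 -> hb_a kappa1 <= hb_a kappa2.
Proof.
move=> k1 k12; have [k32|k32] := leP 32 kappa1; last first.
  have hb_a_small (x : R) : x < 32 -> hb_a x = 1 by rewrite /hb_a leNgt => ->.
  rewrite (hb_a_small _ k32); have [k32'|k32'] := leP 32 kappa2.
    by have := hb_a_gt k32'; lra.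
  by rewrite (hb_a_small _ k32').
have s12 : Num.sqrt kappa1 <= Num.sqrt kappa2 by rewrite ler_sqrt//; lra.
have [a1 b1 c1 ->] := hb_a_largeE k32.
have [a2 b2 c2 ->] := hb_a_largeE (le_trans k32 k12).
move: a1 a2 b1 b2 c1 c2 s12.
set m1 := Num.sqrt (_ * kappa1 - _); set n1 := Num.sqrt kappa1.
set m2 := Num.sqrt (_ * kappa2 - _); set n2 := Num.sqrt kappa2.
move=> a1 a2 b1 b2 c1 c2 s12.
rewrite ler_pdivrMr; last by lra.
rewrite mulrAC ler_pdivlMr; last by lra.
suff : n1 * m2 - n2 * m1 <= n2 - n1 by lra.
have S_gt0 : 0 < n1 * m2 + n2 * m1 by rewrite addr_gt0// mulr_gt0//; lra.
rewrite -(ler_pM2r S_gt0).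
have -> : (n1 * m2 - n2 * m1) * (n1 * m2 + n2 * m1) = (n2 - n1) * (n1 + n2).
  have -> : (n1 * m2 - n2 * m1) * (n1 * m2 + n2 * m1) =
    n1 ^+ 2 * m2 ^+ 2 - n2 ^+ 2 * m1 ^+ 2 by ring.
  by rewrite c1 c2; ring.
apply: ler_wpM2l; first by lra.
have h1 : n1 * 1 <= n1 * m2 by rewrite ler_wpM2l//; lra.
have h2 : n2 * 1 <= n2 * m1 by rewrite ler_wpM2l//; lra.
lra.
Qed.

(** With [s = 1 / sqrt kappa], the quadratic equation for [a] reads
    [(a + s) ^ 2 = 2 + s ^ 2 (1 + a ^ 2)], so [a + s] differs from [sqrt 2] by
    [s ^ 2 (1 + a ^ 2) / (a + s + sqrt 2) <= 3 s ^ 2]. *)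
Lemma hb_a_expansion (R : realType) (kappa : R) : 32 <= kappa ->
  `|hb_a kappa - (Num.sqrt 2 - 1 / Num.sqrt kappa)| <= 3 * (1 / kappa).
Proof.
move=> k32; have sq := hb_a_large_sq k32.
have [|a_gt0 as_lt1 _] := @hb_a_bounds _ kappa; first by lra.
have k_gt0 : 0 < Num.sqrt kappa by rewrite sqrtr_gt0; lra.
have -> : 1 / kappa = (1 / Num.sqrt kappa) ^+ 2.
  by rewrite expr_div_n expr1n sqr_sqrtr//; lra.
have s_gt0 : 0 < 1 / Num.sqrt kappa by rewrite divr_gt0.
have q1 : 1 <= Num.sqrt 2 :> R by rewrite -[X in X <= _]sqrtr1 ler_sqrt; lra.
have q2 : Num.sqrt 2 ^+ 2 = 2 :> R by rewrite sqr_sqrtr.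
have asE : hb_a kappa / Num.sqrt kappa = hb_a kappa * (1 / Num.sqrt kappa).
  by rewrite div1r.
move: sq as_lt1; rewrite asE.
move: a_gt0 s_gt0 q1 q2; set a := hb_a _; set s := 1 / _; set q := Num.sqrt 2.
move=> a_gt0 s_gt0 q1 q2 sq as_lt1.
have as_gt0 : 0 < a * s by rewrite mulr_gt0.
have a2 : a ^+ 2 <= 2 by rewrite sq; nra.
have T_gt0 : 0 < a + s + q by lra.
have -> : a - (q - s) = (s ^+ 2 * (1 + a ^+ 2)) / (a + s + q).
  apply: (mulIf (lt0r_neq0 T_gt0)); rewrite divfK ?lt0r_neq0//.
  have -> : (a - (q - s)) * (a + s + q) = (a + s) ^+ 2 - q ^+ 2 by ring.
  by rewrite q2; move: sq; lra.
rewrite ger0_norm; last by rewrite divr_ge0 ?ltW// mulr_gt0 ?exprn_gt0//; nra.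
rewrite ler_pdivrMr// mulrAC mulrC; nra.
Qed.

(** The difference is [s (sqrt 2 - a)] with [s = 1 / sqrt kappa], and
    [|a - sqrt 2| <= s + 3 s ^ 2 <= 4 s]. *)
Lemma hb_rate_expansion (R : realType) (kappa : R) : 32 <= kappa ->
  `|1 - hb_a kappa / Num.sqrt kappa - (1 - Num.sqrt 2 / Num.sqrt kappa)|
    <= 4 * (1 / kappa).
Proof.
move=> k32; have := hb_a_expansion k32.
have k_gt5 : 5 < Num.sqrt kappa by have [] := hb_a_largeE k32.
have k_gt0 : 0 < Num.sqrt kappa by lra.
have -> : 1 / kappa = (1 / Num.sqrt kappa) ^+ 2.
  by rewrite expr_div_n expr1n sqr_sqrtr//; lra.
have s_gt0 : 0 < 1 / Num.sqrt kappa by rewrite divr_gt0.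
have s_lt1 : 1 / Num.sqrt kappa < 1 by rewrite ltr_pdivrMr//; lra.
rewrite -[hb_a _ / _]mulr1 -[Num.sqrt 2 / _]mulr1 -!mulrA ![_^-1 * 1]mulrC.
set s := 1 / _; set a := hb_a _; set q := Num.sqrt 2.
rewrite -/s in s_gt0 s_lt1 *.
rewrite !ler_norml => /andP[h1 h2].
have h3 := ler_wpM2l (ltW s_gt0) h1; have h4 := ler_wpM2l (ltW s_gt0) h2.
have s3 : s ^+ 2 * s <= s ^+ 2 * 1 by rewrite ler_wpM2l ?sqr_ge0// ltW.
by apply/andP; split; nra.
Qed.

(** * Quadratic functions in an eigenbasis *)

Lemma trmx11E (R : realType) (d : nat) (u v : 'cV[R]_d) :
  (u^T *m v) 0 0 = (v^T *m u) 0 0.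
Proof. by rewrite -[in RHS](trmxK u) -trmx_mul [RHS]mxE. Qed.

Lemma quadratic_along_line (R : realType) (d : nat) (Q : 'M[R]_d)
    (p : 'cV[R]_d) (r : R) (x v : 'cV[R]_d) (h : R) : Q^T = Q ->
  quadratic Q p r (h *: v + x) = quadratic Q p r x
    + h * (v^T *m (Q *m x + p)) 0 0 + h ^+ 2 / 2 * (v^T *m Q *m v) 0 0.
Proof.
move=> Qsym.
have xQv : (x^T *m (Q *m v)) 0 0 = (v^T *m (Q *m x)) 0 0.
  by rewrite trmx11E trmx_mul Qsym mulmxA.
have vxT : (h *: v + x)^T = h *: v^T + x^T by rewrite linearD /= linearZ.
rewrite /quadratic vxT !mulmxDl !mulmxDr -!scalemxAl -!scalemxAr.
by rewrite -!mulmxA !(addmxE, scalemxE) xQv (trmx11E p v); field.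
Qed.

Lemma gradient_quadratic (R : realType) (d : nat) (Q : 'M[R]_d) (p : 'cV[R]_d)
    (r : R) (x : 'cV[R]_d) : Q^T = Q ->
  gradient (quadratic Q p r) x = Q *m x + p.
Proof.
move=> Qsym; apply/colP => i; rewrite mxE.
set v := delta_mx i 0; set q := (v^T *m Q *m v) 0 0.
have gE : (v^T *m (Q *m x + p)) 0 0 = (Q *m x + p) i 0.
  by rewrite trmx_delta -rowE mxE.
apply: cvg_lim => //.
apply: (@cvg_trans _ ((fun h : R => (Q *m x + p) i 0 + h * (q / 2)) @ 0^')).
  apply: near_eq_cvg; near=> h.
  rewrite /= quadratic_along_line// gE -/q /GRing.scale /=.
  field; near: h; exact: nbhs_dnbhs_neq.
apply: cvg_within_filter.
suff : (Q *m x + p) i 0 + h * (q / 2) @[h --> (0 : R)] -->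
    (Q *m x + p) i 0 + 0 * (q / 2) by rewrite mul0r addr0.
by apply: cvgD; [exact: cvg_cst|apply: cvgMl; exact: cvg_id].
Unshelve. all: by end_near. Qed.

(** Otherwise an exact line search along the negative gradient [- g], with step
    [|g| ^ 2 / (g^T Q g)], would decrease the function. *)
Lemma minimizer_stationary (R : realType) (d : nat) (Q : 'M[R]_d)
    (p : 'cV[R]_d) (r : R) (xs : 'cV[R]_d) : sym_posdef Q ->
  minimizer (quadratic Q p r) xs -> Q *m xs + p = 0.
Proof.
move=> [Qsym Qpos] xs_min; apply/eqP/negPn/negP => g_neq0.
set g := Q *m xs + p in g_neq0.
have gQg := Qpos _ g_neq0; set q := (_ *m g) 0 0 in gQg.
have gg : 0 < (g^T *m g) 0 0.
  have gg_ge0 i : 0 <= g^T 0 i * g i 0 by rewrite mxE -expr2 sqr_ge0.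
  rewrite mxE lt0r sumr_ge0// andbT psumr_eq0//; apply: contraNN g_neq0.
  move=> /allP g0; apply/eqP/colP => i; rewrite [RHS]mxE.
  by have := g0 i (mem_index_enum i); rewrite /= mxE mulf_eq0 orbb => /eqP.
have := xs_min ((- ((g^T *m g) 0 0 / q)) *: g + xs).
rewrite quadratic_along_line// -/g -/q -addrA; set n := (_ *m g) 0 0 in gg *.
have -> : - (n / q) * n + (- (n / q)) ^+ 2 / 2 * q = - (n ^+ 2 / (2 * q)).
  by field; exact: lt0r_neq0.
set t := quadratic _ _ _ _.
have e_gt0 : 0 < n ^+ 2 / (2 * q) by rewrite divr_gt0 ?exprn_gt0// mulr_gt0.
lra.
Qed.

Lemma quadratic_gap (R : realType) (d : nat) (Q : 'M[R]_d)
    (p : 'cV[R]_d) (r : R) (xs x : 'cV[R]_d) : sym_posdef Q ->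
  minimizer (quadratic Q p r) xs ->
  quadratic Q p r x - quadratic Q p r xs
    = 2^-1 * ((x - xs)^T *m Q *m (x - xs)) 0 0.
Proof.
move=> Qpd xs_min; have [Qsym _] := Qpd.
rewrite -[x in LHS](subrK xs) -{1}[x - xs]scale1r quadratic_along_line//.
rewrite (minimizer_stationary Qpd xs_min) mulmx0 mxE mulr0 addr0.
by rewrite addrAC subrr add0r expr1n mul1r.
Qed.

Section Eigenbasis.
Variables (R : realType) (d : nat) (Q U : 'M[R]_d) (lam : 'rV[R]_d).
Hypothesis QUlam : orthogonal_eigendecomposition Q U lam.

Lemma eigenbasis_trK : U^T *m U = 1%:M.
Proof. by have [/mulmx1C] := QUlam. Qed.

Lemma eigenbasis_mulQ : U^T *m Q = diag_mx lam *m U^T.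
Proof. by have [_ -> _] := QUlam; rewrite !mulmxA eigenbasis_trK mul1mx. Qed.

Lemma eigenbasis_coord_mulQ (x : 'cV[R]_d) i :
  (U^T *m (Q *m x)) i 0 = lam 0 i * (U^T *m x) i 0.
Proof. by rewrite mulmxA eigenbasis_mulQ -mulmxA mul_diag_mx mxE. Qed.

Lemma quadform_eigenbasis (x : 'cV[R]_d) :
  (x^T *m Q *m x) 0 0 = \sum_i lam 0 i * (U^T *m x) i 0 ^+ 2.
Proof.
have [UU _ _] := QUlam.
rewrite -[x^T]mulmx1 -UU -!mulmxA mulmxA -[x^T *m U]trmxK trmx_mul trmxK mxE.
by apply: eq_bigr => i _; rewrite eigenbasis_coord_mulQ mxE expr2 mulrCA.
Qed.

Lemma sqnorm2_eigenbasis (x : 'cV[R]_d) : sqnorm2 (U^T *m x) = sqnorm2 x.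
Proof.
have sqnorm2E (y : 'cV[R]_d) : sqnorm2 y = (y^T *m y) 0 0.
  by rewrite mxE; apply: eq_bigr => i _; rewrite mxE expr2.
have [UU _ _] := QUlam.
by rewrite !sqnorm2E trmx_mul trmxK mulmxA -(mulmxA x^T) UU mulmx1.
Qed.

Lemma eigenvalue_lam i : eigenvalue Q (lam 0 i).
Proof.
apply/eigenvalueP; exists (row i U^T).
  by rewrite -row_mul eigenbasis_mulQ row_mul row_diag_mx -scalemxAl -rowE.
apply/eqP => /rowP; have [UU _ _] := QUlam.
move=> Ui0; have := eigenbasis_trK; move/matrixP/(_ i i); rewrite !mxE eqxx.
rewrite big1 => [/esym/eqP|j _]; first by rewrite oner_eq0.
by have := Ui0 j; rewrite !mxE => ->; rewrite mul0r.
Qed.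

Lemma eigenvalue_lamP e : eigenvalue Q e -> exists i, e = lam 0 i.
Proof.
case/eigenvalueP => v vQ v_neq0; have [UU QE _] := QUlam.
have [i vUi] : exists i, (v *m U) 0 i != 0.
  apply/rV0Pn; apply: contra_neq v_neq0 => vU0.
  by rewrite -[v]mulmx1 -UU mulmxA vU0 mul0mx.
exists i; apply: (mulIf vUi).
have : v *m Q *m U = e *: (v *m U) by rewrite vQ -scalemxAl.
rewrite QE -!mulmxA eigenbasis_trK mulmx1 mulmxA => /rowP/(_ i).
by rewrite mul_mx_diag [LHS]mxE [RHS]mxE => <-; rewrite mulrC.
Qed.
End Eigenbasis.

(** * Spectrum of the iteration matrix *)

(** Write [v = x + i y] and [z = a + i b]. Symmetry of [Q] equates [x Q y^T]
    with [y Q x^T], which gives [b (|x| ^ 2 + |y| ^ 2) = 0]; then [x Q = a x],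
    [y Q = a y], and one of [x], [y] is nonzero. *)
Lemma complex_eigenvalue_symmetric (R : realType) (d : nat) (Q : 'M[R]_d)
    (v : 'rV[R[i]]_d) (z : R[i]) : Q^T = Q ->
  v *m complexmx Q = z *: v -> v != 0 ->
  exists2 e : R, z = real_complex R e & eigenvalue Q e.
Proof.
move=> Qsym vQ v_neq0; case: z vQ => a b vQ.
pose vr : 'rV[R]_d := map_mx (@complex.Re R) v.
pose vi : 'rV[R]_d := map_mx (@complex.Im R) v.
have vrQ : vr *m Q = a *: vr - b *: vi.
  rewrite -Re_mulmx vQ; apply/rowP => i; rewrite !mxE.
  by case: (v 0 i).
have viQ : vi *m Q = b *: vr + a *: vi.
  rewrite -Im_mulmx vQ; apply/rowP => i; rewrite !mxE.
  by case: (v 0 i) => x y /=; rewrite addrC.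
have vri_neq0 : (vr != 0) || (vi != 0).
  rewrite -negb_and; apply: contra_neqN v_neq0 => /andP[/eqP/rowP r0 /eqP/rowP i0].
  apply/rowP => j; have := r0 j; have := i0 j; rewrite !mxE.
  by case: (v 0 j) => x y /= -> ->.
have dot_ge0 (u : 'rV[R]_d) : 0 <= (u *m u^T) 0 0.
  by rewrite mxE sumr_ge0// => i _; rewrite mxE -expr2 sqr_ge0.
have dot_gt0 (u : 'rV[R]_d) : u != 0 -> 0 < (u *m u^T) 0 0.
  move=> /rV0Pn[i ui]; rewrite mxE (bigD1 i)//= ltr_pwDl ?sumr_ge0//.
    by rewrite mxE -expr2 exprn_even_gt0.
  by move=> j _; rewrite mxE -expr2 sqr_ge0.
have b0 : b = 0.
  have : (vr *m Q *m vi^T) 0 0 = (vi *m Q *m vr^T) 0 0.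
    have -> : vi *m Q *m vr^T = (vr *m Q *m vi^T)^T.
      by rewrite !trmx_mul trmxK Qsym mulmxA.
    by rewrite [RHS]mxE.
  have vir : (vi *m vr^T) 0 0 = (vr *m vi^T) 0 0.
    have -> : vi *m vr^T = (vr *m vi^T)^T by rewrite trmx_mul trmxK.
    by rewrite [LHS]mxE.
  rewrite vrQ viQ mulmxDl mulNmx -!scalemxAl mulmxDl -!scalemxAl.
  rewrite !(addmxE, oppmxE, scalemxE) vir => h.
  have : b * ((vr *m vr^T) 0 0 + (vi *m vi^T) 0 0) = 0 by lra.
  move/eqP; rewrite mulf_eq0 => /orP[/eqP//|/eqP].
  have := dot_ge0 vr; have := dot_ge0 vi.
  by case/orP: vri_neq0 => /dot_gt0; lra.
exists a; first by rewrite b0.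
move: vrQ viQ; rewrite b0 !scale0r subr0 add0r => vrQ viQ.
by case/orP: vri_neq0 => u0; apply/eigenvalueP; [exists vr|exists vi].
Qed.

(** For a left eigenvector [(v1, v2)] the second block gives
    [v2 = - (beta / z) v1], and the first one then makes [v1] a left
    eigenvector of [Q]. *)
Lemma complex_eigenvalue_A_mx (R : realType) (d : nat) (Q : 'M[R]_d)
    (alpha beta : R) (z : R[i]) : Q^T = Q -> alpha != 0 -> beta != 0 ->
  eigenvalue (complexmx (A_mx Q alpha beta 0)) z ->
  exists2 e : R, eigenvalue Q e &
    z ^+ 2 - real_complex R (1 + beta - alpha * e) * z + real_complex R beta = 0.
Proof.
move=> Qsym a0 b0 /eigenvalueP[v]; rewrite -[v]hsubmxK.
set v1 := lsubmx v; set v2 := rsubmx v => vA v_neq0.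
move: vA; rewrite /complexmx /A_mx map_block_mx mul_row_block scale_row_mx.
rewrite addr0 mulr1 mulr0 scale0r addr0 map_mxB map_mxN !map_mxZ !map_scalar_mx.
rewrite rmorph1 map_mx0 mulmx1 mulmx0 addr0.
rewrite mulmxN mul_mx_scalar mulmxBr mul_mx_scalar -scalemxAr.
move=> /eq_row_mx[E1 E2].
set bC := real_complex R beta in E1 E2 *; set aC := real_complex R alpha in E1 E2 *.
have bC0 : bC != 0 by rewrite fmorph_eq0.
have aC0 : aC != 0 by rewrite fmorph_eq0.
have v1_neq0 : v1 != 0.
  apply: contra_neq v_neq0 => v10; move: E1; rewrite v10 mul0mx !scaler0 subr0 add0r.
  by move=> ->; rewrite row_mx0.
have z0 : z != 0.
  apply: contra_neq v1_neq0 => z0; move: E2 => /eqP.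
  by rewrite z0 scale0r oppr_eq0 scaler_eq0 (negPf bC0) => /eqP.
have v2E : v2 = (- bC / z) *: v1.
  by rewrite mulrC -scalerA scaleNr E2 scalerA mulVf// scale1r.
have : v1 *m complexmx Q = ((1 + bC - bC / z - z) / aC) *: v1.
  apply: (scalerI aC0); rewrite scalerA mulrC divfK//.
  rewrite !scalerBl -E1 v2E rmorphD rmorph1 -/bC mulNr scaleNr.
  by rewrite [X in _ - X]addrAC opprB; apply/esym/subrKC.
case/(complex_eigenvalue_symmetric Qsym)/(_ v1_neq0) => e eE Qe.
exists e => //.
have -> : real_complex R (1 + beta - alpha * e) = 1 + bC - aC * real_complex R e.
  by rewrite rmorphB rmorphM rmorphD rmorph1.
rewrite -eE.
by field; apply/andP; split.
Qed.

(** Used twice: it shows that the heavy-ball rate is attained (double root [b]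
    at [mu]), and that [z = 1] is an eigenvalue when [alpha = 0]. *)
Lemma eigenvalue_A_mx (R : realType) (d : nat) (Q : 'M[R]_d)
    (alpha beta nu e z : R) : eigenvalue Q e -> z != 0 ->
  z ^+ 2 - (1 + beta - alpha * (1 + nu) * e) * z + (beta - alpha * nu * e) = 0 ->
  eigenvalue (complexmx (A_mx Q alpha beta nu)) (real_complex R z).
Proof.
move=> /eigenvalueP[u uQ u_neq0] z0 zE; rewrite eigenvalue_map.
apply/eigenvalueP; exists (row_mx u (((- beta + alpha * nu * e) / z) *: u)); last first.
  by apply: contra_neq u_neq0 => /eqP; rewrite row_mx_eq0 => /andP[/eqP].
rewrite mul_row_block mulmx1 mulmx0 addr0 mulmxBr !mulmxDr mulmxN.
rewrite !mul_mx_scalar -!scalemxAr uQ !scalerA -!scaleNr -!scalerDl scale_row_mx.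
congr row_mx; last by rewrite scalerA [z * _]mulrC divfK.
congr (_ *: _); apply: (mulIf z0); rewrite mulrDl divfK//.
by move: zE; rewrite /GRing.scale /=; lra.
Qed.

(** The roots are conjugate or equal, and their product is [b ^ 2]. *)
Lemma normc_quadratic_root (R : realType) (b c : R) (z : R[i]) :
  0 <= b -> c ^+ 2 <= 4 * b ^+ 2 ->
  z ^+ 2 - real_complex R c * z + real_complex R (b ^+ 2) = 0 -> normc z = b.
Proof.
move=> b0 cb; case: z => x y; rewrite expr2 => -[/= E1 E2].
have {}E1 : x ^+ 2 - y ^+ 2 - c * x + b ^+ 2 = 0 by move: E1; lra.
have {}E2 : y * (2 * x - c) = 0 by move: E2; lra.
suff h : x ^+ 2 + y ^+ 2 = b ^+ 2 by rewrite h sqrtr_sqr ger0_norm.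
move/eqP: E2; rewrite mulf_eq0 => /orP[/eqP y0|/eqP xc].
  have xc0 : (2 * x - c) ^+ 2 <= 0 by move: E1; rewrite y0 => E1; lra.
  have /eqP : (2 * x - c) ^+ 2 = 0 by apply/eqP; rewrite eq_le xc0 sqr_ge0.
  by rewrite sqrf_eq0 => /eqP xc; move: E1; nra.
have {}xc : c = 2 * x by lra.
by move: E1; rewrite xc; lra.
Qed.

(** A supremum dominates the elements of its set only when the set is bounded;
    here the sum of the moduli of all roots of the characteristic polynomial is
    a bound. *)
Lemma spectral_radius_ge (R : realType) (n : nat) (M : 'M[R]_n) (z : R[i]) :
  eigenvalue (complexmx M) z -> normc z <= spectral_radius M.
Proof.
move=> Mz; apply: ub_le_sup; last by exists z.
have [rs rsE] := closed_field_poly_normal (char_poly (complexmx M)).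
exists (\sum_(r <- rs) normc r) => _ [w /= Mw <-].
have : w \in rs.
  have := eigenvalue_root_char (complexmx M) w; rewrite Mw rsE => /esym.
  by rewrite rootZ ?root_prod_XsubC// lead_coef_eq0 monic_neq0// char_poly_monic.
move=> /(big_rem (op := +%R) w) ->; rewrite lerDl.
by apply: sumr_ge0 => y _; exact: normc_ge0.
Qed.

(** With step size zero every constant sequence is a trajectory, so [1] is an
    eigenvalue of the iteration matrix. *)
Lemma stable_step_neq0 (R : realType) (d : nat) (Q : 'M[R]_d) (e alpha beta nu : R) :
  eigenvalue Q e -> spectral_radius (A_mx Q alpha beta nu) < 1 -> alpha != 0.
Proof.
move=> Qe; apply: contraTneq => ->; rewrite -leNgt.
have := @eigenvalue_A_mx _ _ Q 0 beta nu e 1 Qe (oner_neq0 _).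
rewrite !mul0r subr0 mulr1 expr1n => /(_ _)/spectral_radius_ge.
rewrite normc1; apply; ring.
Qed.

Lemma spectral_radius_heavy_ball (R : realType) (d : nat) (Q : 'M[R]_d)
    (mu L alpha b : R) : Q^T = Q ->
  smallest_eigenvalue Q mu -> largest_eigenvalue Q L ->
  0 < alpha -> 0 < b -> alpha * mu = (1 - b) ^+ 2 -> alpha * L <= (1 + b) ^+ 2 ->
  spectral_radius (A_mx Q alpha (b ^+ 2) 0) = b.
Proof.
move=> Qsym [Qmu mu_min] [_ L_max] a0 b0 amu aL.
rewrite /spectral_radius; suff -> : [set normc z | z in
  [set z | eigenvalue (complexmx (A_mx Q alpha (b ^+ 2) 0)) z]] = [set b].
  exact: sup1.
apply/seteqP; split => [_ [z /= Az <-]|_ /= ->].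
  have [e Qe] := complex_eigenvalue_A_mx Qsym (lt0r_neq0 a0)
    (expf_neq0 2 (lt0r_neq0 b0)) Az.
  apply: normc_quadratic_root; first exact: ltW.
  have h1 := ler_wpM2l (ltW a0) (mu_min _ Qe).
  have h2 := ler_wpM2l (ltW a0) (L_max _ Qe).
  rewrite -subr_ge0; set c := 1 + _ - _.
  have -> : 4 * b ^+ 2 - c ^+ 2 = (2 * b - c) * (2 * b + c) by ring.
  by rewrite mulr_ge0 /c//; lra.
exists (real_complex R b); last by rewrite /normc /= expr0n addr0 sqrtr_sqr gtr0_norm.
apply: (@eigenvalue_A_mx _ _ _ _ _ _ mu) => //=; first exact: lt0r_neq0.
by rewrite addr0 mulr1 mulr0 mul0r subr0 amu; ring.
Qed.

(** * The transfer matrix on the unit circle *)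

Lemma cnorm2_sqr (R : realType) (n : nat) (v : 'cV[R[i]]_n) :
  cnorm2 v ^+ 2 = \sum_i normc (v i 0) ^+ 2.
Proof. by rewrite sqr_sqrtr// sumr_ge0// => i _; exact: sqr_ge0. Qed.

Lemma cnorm2_ge0 (R : realType) (n : nat) (v : 'cV[R[i]]_n) : 0 <= cnorm2 v.
Proof. exact: sqrtr_ge0. Qed.

Lemma cnorm2_0 (R : realType) (n : nat) : cnorm2 (0 : 'cV[R[i]]_n) = 0.
Proof.
by apply/eqP; rewrite -sqrf_eq0 cnorm2_sqr big1// => i _; rewrite mxE normc0 expr0n.
Qed.

(** A real orthogonal matrix acts separately, and isometrically, on the real
    and imaginary parts. *)
Lemma cnorm2_eigenbasis (R : realType) (d : nat) (Q U : 'M[R]_d)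
    (lam : 'rV[R]_d) (v : 'cV[R[i]]_d) : orthogonal_eigendecomposition Q U lam ->
  cnorm2 (complexmx U^T *m v) = cnorm2 v.
Proof.
move=> QUlam.
have split_norm (w : 'cV[R[i]]_d) : cnorm2 w ^+ 2
    = sqnorm2 (map_mx (@complex.Re R) w) + sqnorm2 (map_mx (@complex.Im R) w).
  rewrite cnorm2_sqr -big_split; apply: eq_bigr => i _; rewrite !mxE.
  by case: (w i 0) => x y; rewrite normc_sqr.
apply/eqP; rewrite -(eqrXn2 (n := 2))// ?cnorm2_ge0// !split_norm.
have -> : complexmx U^T *m v = (v^T *m complexmx U)^T.
  by rewrite trmx_mul trmxK /complexmx map_trmx.
rewrite -!map_trmx Re_mulmx Im_mulmx !trmx_mul !map_trmx !trmxK.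
by rewrite !(sqnorm2_eigenbasis QUlam).
Qed.

Lemma resolvent_unit (R : realType) (n : nat) (M : 'M[R]_n) (z : R[i]) :
  ~~ eigenvalue (complexmx M) z -> z%:M - complexmx M \in unitmx.
Proof.
rewrite /eigenvalue /eigenspace negbK kermx_eq0 row_free_unit => h.
by rewrite -opprB -scaleN1r unitmxZ// unitrN1.
Qed.

(** The transfer matrix is diagonal in the eigenbasis. The vector [eta] holds the
    coordinates of the delayed state (second block of the resolvent applied to
    [B v]); keeping the scalar equation for [eta] unsolved avoids dividing by
    the symbol [z ^ 2 - c z + beta]. *)
Lemma transfer_eigenbasis (R : realType) (d : nat) (Q U : 'M[R]_d)
    (lam : 'rV[R]_d) (alpha beta : R) (z : R[i]) (v : 'cV[R[i]]_d) :
  orthogonal_eigendecomposition Q U lam ->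
  ~~ eigenvalue (complexmx (A_mx Q alpha beta 0)) z ->
  exists eta : 'cV[R[i]]_d, forall i,
    (z ^+ 2 - real_complex R (1 + beta - alpha * lam 0 i) * z
       + real_complex R beta) * eta i 0
      = - real_complex R alpha * (complexmx U^T *m v) i 0
    /\ (transfer_mx Q U lam alpha beta 0 z *m v) i 0
      = real_complex R ((Num.sqrt 2)^-1 * Num.sqrt (lam 0 i)) * (z * eta i 0).
Proof.
move=> QUlam /resolvent_unit zA_unit.
set y := invmx (z%:M - complexmx (A_mx Q alpha beta 0))
           *m (complexmx (B_mx d alpha) *m v).
have : (z%:M - complexmx (A_mx Q alpha beta 0)) *m y = complexmx (B_mx d alpha) *m v.
  by rewrite /y mulmxA mulmxV// mul1mx.
have TyE : transfer_mx Q U lam alpha beta 0 z *m v = complexmx (T_mx U lam) *m y.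
  by rewrite /transfer_mx /y !mulmxA.
rewrite -[y]vsubmxK in TyE *.
move: TyE; set y1 := usubmx y; set y2 := dsubmx y => TyE.
rewrite {1}/complexmx /A_mx map_block_mx addr0 mulr1 mulr0 scale0r addr0.
rewrite map_mxB map_mxN map_mxZ !map_scalar_mx rmorph1 map_mx0.
rewrite scalar_mx_block opp_block_mx add_block_mx mul_block_col.
rewrite /B_mx /complexmx map_col_mx map_mx0 mul_col_mx mul0mx => /eq_col_mx[E1 E2].
have {}E2 : y1 = z *: y2.
  move: E2; rewrite !sub0r subr0 mulNmx mul1mx mul_scalar_mx => /eqP.
  by rewrite addrC subr_eq0 => /eqP.
move: TyE E1; rewrite E2 {y1 E2} => TyE E1.
have diagE (D : 'rV[R[i]]_d) (w : 'cV[R[i]]_d) j :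
  (diag_mx D *m w) j 0 = D 0 j * w j 0 by rewrite mul_diag_mx mxE.
have mapE (aT rT : Type) (f : aT -> rT) m n (M : 'M[aT]_(m, n)) j k :
  map_mx f M j k = f (M j k) by rewrite mxE.
exists (complexmx U^T *m y2) => i; split; last first.
  rewrite TyE /T_mx /complexmx map_row_mx mul_row_col map_mx0 mul0mx addr0.
  rewrite map_mxZ map_mxM map_diag_mx -scalemxAl -scalemxAr.
  rewrite [LHS]mxE [X in _ * X]mxE -mulmxA diagE !mapE rmorphM /=.
  rewrite -/(complexmx U^T); ring.
have QE : complexmx U^T *m (complexmx Q *m y2)
    = diag_mx (map_mx (real_complex R) lam) *m (complexmx U^T *m y2).
  rewrite mulmxA -map_mxM (eigenbasis_mulQ QUlam) map_mxM map_diag_mx.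
  by rewrite -mulmxA.
have /colP/(_ i) := congr1 (mulmx (complexmx U^T)) E1.
rewrite map_mxN map_scalar_mx sub0r opprK !mulmxBl !mulNmx !mul_scalar_mx.
rewrite -scalemxAl -scalemxAr mulmxDr !mulmxBr mulmxN -!scalemxAr QE.
rewrite !(addmxE, oppmxE, scalemxE) diagE mapE => E.
rewrite rmorphB rmorphM mulNr -E; ring.
Qed.

(** [frequency_bound] for [c = 1 + b ^ 2 - alpha e]; the symbol is [z] times
    [z - c + b ^ 2 / z], and [1 / z] is the conjugate of [z]. *)
Lemma symbol_bound (R : realType) (alpha b mu e : R) (z : R[i]) :
  0 < alpha -> 0 < b -> alpha * mu = (1 - b) ^+ 2 -> mu <= e ->
  alpha * e <= 1 + b ^+ 2 -> normc z = 1 ->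
  alpha ^+ 2 * e * mu <=
    normc (z ^+ 2 - real_complex R (1 + b ^+ 2 - alpha * e) * z
             + real_complex R (b ^+ 2)) ^+ 2.
Proof.
move=> a0 b0 amu mue ae z1; set c := 1 + b ^+ 2 - alpha * e.
have ame := ler_wpM2l (ltW a0) mue.
have c_ge0 : 0 <= c by rewrite /c; lra.
have c_le : c <= 2 * b by rewrite /c; move: ame; rewrite amu; lra.
case: z z1 => u s z1.
have us : u ^+ 2 + s ^+ 2 = 1 by rewrite -normc_sqr z1 expr1n.
have := frequency_bound b0 c_ge0 c_le us.
have -> : (1 + b ^+ 2 - c) * (1 - b) ^+ 2 = alpha ^+ 2 * e * mu.
  by rewrite -amu /c; ring.
move=> /le_trans; apply.
have -> : Complex u s ^+ 2 - real_complex R c * Complex u s + real_complex R (b ^+ 2)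
    = Complex u s * Complex (u - c + b ^+ 2 * u) (s - b ^+ 2 * s).
  rewrite expr2; apply/eqP; rewrite eq_complex /=; apply/andP.
  by split; apply/eqP; [rewrite -[b ^+ 2 in LHS]mulr1 -us|]; ring.
by rewrite normcM z1 mul1r normc_sqr.
Qed.

(** In the coordinate of the eigenvalue [lam], the transfer matrix multiplies
    the squared modulus by [alpha ^ 2 lam / 2] over the squared modulus of the
    symbol, which is at least [alpha ^ 2 lam mu]. *)
Lemma transfer_gain (R : realType) (d : nat) (Q U : 'M[R]_d) (lam : 'rV[R]_d)
    (alpha b mu : R) (z : R[i]) (v : 'cV[R[i]]_d) :
  orthogonal_eigendecomposition Q U lam -> 0 < mu ->
  0 < alpha -> 0 < b -> alpha * mu = (1 - b) ^+ 2 ->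
  (forall i, mu <= lam 0 i) -> (forall i, alpha * lam 0 i <= 1 + b ^+ 2) ->
  normc z = 1 -> ~~ eigenvalue (complexmx (A_mx Q alpha (b ^+ 2) 0)) z ->
  cnorm2 (transfer_mx Q U lam alpha (b ^+ 2) 0 z *m v)
    <= 1 / Num.sqrt (2 * mu) * cnorm2 v.
Proof.
move=> QUlam mu0 a0 b0 amu lam_ge lam_le z1 z_reg.
have [eta etaE] := transfer_eigenbasis v QUlam z_reg.
have s_gt0 : 0 < Num.sqrt (2 * mu) by rewrite sqrtr_gt0 mulr_gt0.
have g_ge0 : 0 <= 1 / Num.sqrt (2 * mu) by rewrite divr_ge0 ?ltW.
rewrite -ler_sqr ?nnegrE ?cnorm2_ge0//; last exact: mulr_ge0 (cnorm2_ge0 _).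
have mu2_ge0 : 0 <= 2 * mu by rewrite mulr_ge0// ltW.
rewrite exprMn expr_div_n expr1n (sqr_sqrtr mu2_ge0).
rewrite -(cnorm2_eigenbasis v QUlam) !cnorm2_sqr mulr_sumr; apply: ler_sum => i _.
have [E1 ->] := etaE i.
have lam0 : 0 < lam 0 i by apply: lt_le_trans (lam_ge i).
have := symbol_bound a0 b0 amu (lam_ge i) (lam_le i) z1.
move/(ler_wpM2r (sqr_ge0 (normc (eta i 0)))); rewrite -exprMn -normcM E1.
rewrite !normcM z1 mul1r normcN !normc_real !exprMn.
rewrite real_normK ?num_real// real_normK ?num_real// exprMn exprVn.
rewrite !sqr_sqrtr//; last exact: ltW.
set n := normc (eta i 0) ^+ 2; set w := normc _ ^+ 2 => h.
have am_gt0 : 0 < 2 * mu * alpha ^+ 2 by rewrite !mulr_gt0// exprn_gt0.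
rewrite -(ler_pM2l am_gt0).
have -> : 2 * mu * alpha ^+ 2 * (1 / (2 * mu) * w) = alpha ^+ 2 * w.
  by field; exact: lt0r_neq0.
by apply: le_trans h; rewrite le_eqVlt; apply/orP; left; apply/eqP; field.
Qed.

Lemma spectral_norm_le (R : realType) (m n : nat) (M : 'M[R[i]]_(m, n)) (g : R) :
  0 <= g -> (forall v, cnorm2 (M *m v) <= g * cnorm2 v) -> spectral_norm M <= g.
Proof.
move=> g0 Mg; apply: ge_sup => [|_ [v /= v1 <-]].
  by exists (cnorm2 (M *m 0)), 0 => //=; rewrite cnorm2_0.
by apply: le_trans (Mg v) _; rewrite ler_piMr.
Qed.

(** A finite [g] bounds the set of values, so that its supremum dominates
    each of them. *)
Lemma spectral_norm_ge (R : realType) (m n : nat) (M : 'M[R[i]]_(m, n)) (g : R)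
    (v : 'cV[R[i]]_n) : 0 <= g -> (forall v, cnorm2 (M *m v) <= g * cnorm2 v) ->
  cnorm2 v <= 1 -> cnorm2 (M *m v) <= spectral_norm M.
Proof.
move=> g0 Mg v1; apply: ub_le_sup; last by exists v.
exists g => _ [w /= w1 <-]; by apply: le_trans (Mg w) _; rewrite ler_piMr.
Qed.

(** At [z = 1] the symbol of the eigenvalue [mu] is [alpha mu], so the
    transfer matrix scales the norm of an eigenvector of [mu] by
    [sqrt (mu / 2) / mu = 1 / sqrt (2 mu)], the upper bound valid on the whole
    circle. *)
Lemma hinf_heavy_ball (R : realType) (d : nat) (Q U : 'M[R]_d) (lam : 'rV[R]_d)
    (alpha b mu : R) (i0 : 'I_d) :
  orthogonal_eigendecomposition Q U lam -> 0 < mu ->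
  0 < alpha -> 0 < b -> alpha * mu = (1 - b) ^+ 2 -> lam 0 i0 = mu ->
  (forall i, mu <= lam 0 i) -> (forall i, alpha * lam 0 i <= 1 + b ^+ 2) ->
  (forall z, normc z = 1 -> ~~ eigenvalue (complexmx (A_mx Q alpha (b ^+ 2) 0)) z) ->
  hinf_norm Q U lam alpha (b ^+ 2) 0 = 1 / Num.sqrt (2 * mu) /\
  spectral_norm (transfer_mx Q U lam alpha (b ^+ 2) 0 1) = 1 / Num.sqrt (2 * mu).
Proof.
move=> QUlam mu0 a0 b0 amu lam_i0 lam_ge lam_le z_reg.
have g0 : 0 <= 1 / Num.sqrt (2 * mu) by rewrite divr_ge0 ?sqrtr_ge0.
have gain z v (z1 : normc z = 1) :=
  transfer_gain v QUlam mu0 a0 b0 amu lam_ge lam_le z1 (z_reg z z1).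
have n1 : normc 1 = 1 :> R by exact: normc1.
have at1 : spectral_norm (transfer_mx Q U lam alpha (b ^+ 2) 0 1) = 1 / Num.sqrt (2 * mu).
  apply/eqP; rewrite eq_le; apply/andP; split.
    by apply: spectral_norm_le => // v; exact: gain.
  (* The column of [U] of index [i0] is a unit eigenvector of [mu]. *)
  pose v : 'cV[R[i]]_d := complexmx U *m delta_mx i0 0.
  have UtU : complexmx U^T *m complexmx U = 1%:M.
    by rewrite -map_mxM (eigenbasis_trK QUlam) map_mx1.
  have Uv : complexmx U^T *m v = delta_mx i0 0 by rewrite /v mulmxA UtU mul1mx.
  have v1 : cnorm2 v = 1.
    apply/eqP; rewrite -(eqrXn2 (n := 2))// ?cnorm2_ge0// expr1n.
    rewrite -(cnorm2_eigenbasis v QUlam) Uv cnorm2_sqr (bigD1 i0)//=.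
    rewrite mxE !eqxx normc1 expr1n big1 ?addr0// => j /negPf ji.
    by rewrite mxE ji normc0 expr0n.
  have v_le1 : cnorm2 v <= 1 by rewrite v1.
  apply: le_trans (spectral_norm_ge g0 (fun v => gain 1 v n1) v_le1).
  have [eta etaE] := transfer_eigenbasis v QUlam (z_reg 1 n1).
  rewrite -ler_sqr ?nnegrE ?cnorm2_ge0// cnorm2_sqr (bigD1 i0)//=.
  apply: ler_wpDr; first by apply: sumr_ge0 => j _; exact: sqr_ge0.
  have [E1 ->] := etaE i0.
  have eta_i0 : eta i0 0 = - (real_complex R mu)^-1.
    have muC0 : real_complex R mu != 0 by rewrite fmorph_eq0 lt0r_neq0.
    have aC0 : real_complex R alpha != 0 by rewrite fmorph_eq0 lt0r_neq0.
    apply: (mulfI (mulf_neq0 aC0 muC0)).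
    have -> : real_complex R alpha * real_complex R mu * - (real_complex R mu)^-1
      = - real_complex R alpha by field.
    have delta1 : (delta_mx i0 0 : 'cV[R[i]]_d) i0 0 = 1 by rewrite mxE !eqxx.
    move: E1; rewrite Uv delta1 (mulr1 (- real_complex R alpha)) lam_i0 => <-; congr (_ * _).
    by rewrite !(rmorphB, rmorphD, rmorphM, rmorph1, rmorphXn); ring.
  rewrite eta_i0 !normcM normcN normcV n1 !normc_real lam_i0 !mul1r.
  rewrite (gtr0_norm mu0) ger0_norm ?mulr_ge0 ?invr_ge0 ?sqrtr_ge0//.
  have mu2_ge0 : 0 <= 2 * mu by rewrite mulr_ge0// ltW.
  rewrite !(exprMn, exprVn) (sqr_sqrtr mu2_ge0) (sqr_sqrtr (ltW mu0)) sqr_sqrtr//.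
  by rewrite le_eqVlt; apply/orP; left; apply/eqP; field; exact: lt0r_neq0.
split=> //; apply/eqP; rewrite eq_le; apply/andP; split.
  apply: ge_sup => [|_ [z /= z1 <-]].
    by exists (spectral_norm (transfer_mx Q U lam alpha (b ^+ 2) 0 1)), 1.
  by apply: spectral_norm_le => // v; exact: gain.
rewrite -at1; apply: ub_le_sup; last by exists 1.
exists (1 / Num.sqrt (2 * mu)) => _ [z /= z1 <-].
by apply: spectral_norm_le => // v; exact: gain.
Qed.

(** * Upper bound on the l2 gain *)

Lemma gmm_stateS (R : realType) (d : nat) (Q : 'M[R]_d) (p : 'cV[R]_d) (r : R)
    (xs x0 : 'cV[R]_d) (alpha beta nu : R) (w : nat -> 'cV[R]_d) (k : nat) :
  Q^T = Q -> Q *m xs + p = 0 ->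
  let s := gmm_state alpha beta nu (quadratic Q p r) w x0 in
  (s k.+1).1 - xs = ((s k).1 - xs)
      - alpha *: (Q *m (((s k).1 - xs) + nu *: ((s k).1 - (s k).2)) + w k)
      + beta *: ((s k).1 - (s k).2)
  /\ (s k.+1).2 = (s k).1.
Proof.
move=> Qsym xs_stat s.
have -> : s k.+1 = let: (x, y) := s k in
    (x - alpha *: (gradient (quadratic Q p r) (x + nu *: (x - y)) + w k)
       + beta *: (x - y), x) by [].
case: (s k) => x y /=; split=> //; rewrite gradient_quadratic//.
have -> : p = - (Q *m xs) by apply/eqP; rewrite -addr_eq0 addrC xs_stat.
rewrite -mulmxBr [x + _ - xs]addrAC.
by rewrite !(addrAC _ _ (- xs)).
Qed.

Lemma gmm_coordS (R : realType) (d : nat) (Q U : 'M[R]_d) (lam : 'rV[R]_d)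
    (p : 'cV[R]_d) (r : R) (xs x0 : 'cV[R]_d) (alpha beta nu : R)
    (w : nat -> 'cV[R]_d) (k : nat) (i : 'I_d) :
  orthogonal_eigendecomposition Q U lam -> Q^T = Q -> Q *m xs + p = 0 ->
  let s := gmm_state alpha beta nu (quadratic Q p r) w x0 in
  let X k := (U^T *m ((s k).1 - xs)) i 0 in
  let Y k := (U^T *m ((s k).2 - xs)) i 0 in
  X k.+1 = X k - alpha * (lam 0 i * (X k + nu * (X k - Y k)) + (U^T *m w k) i 0)
    + beta * (X k - Y k) /\ Y k.+1 = X k.
Proof.
move=> QUlam Qsym xs_stat s X Y.
have [E1 E2] := gmm_stateS r x0 alpha beta nu w k Qsym xs_stat.
rewrite -/s in E1 E2; rewrite /X /Y E1 E2; split=> //.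
have -> : (s k).1 - (s k).2 = ((s k).1 - xs) - ((s k).2 - xs).
  by rewrite opprB addrA subrK.
set x := (s k).1 - xs; set y := (s k).2 - xs.
have coordD (A B : 'cV[R]_d) : (U^T *m (A + B)) i 0 = (U^T *m A) i 0 + (U^T *m B) i 0.
  by rewrite mulmxDr addmxE.
have coordN (A : 'cV[R]_d) : (U^T *m (- A)) i 0 = - (U^T *m A) i 0.
  by rewrite mulmxN oppmxE.
have coordZ c (A : 'cV[R]_d) : (U^T *m (c *: A)) i 0 = c * (U^T *m A) i 0.
  by rewrite -scalemxAr scalemxE.
by rewrite !(coordD, coordN, coordZ, eigenbasis_coord_mulQ QUlam).
Qed.

(** The dissipation inequality is summed over time and over the eigenbasis; the
    scaling [2 mu alpha ^ 2] turns its coefficient [alpha ^ 2 lam mu] into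
    [lam / 2] and the weight of the errors into [1 / (2 mu)]. The function of
    the initial point is the initial storage, which vanishes at the
    minimizer. *)
Lemma heavy_ball_admissible (R : realType) (d : nat) (Q U : 'M[R]_d)
    (lam : 'rV[R]_d) (p : 'cV[R]_d) (r : R) (xs : 'cV[R]_d) (alpha b mu : R) :
  orthogonal_eigendecomposition Q U lam -> sym_posdef Q ->
  minimizer (quadratic Q p r) xs -> 0 < mu ->
  0 < alpha -> 0 < b -> b < 1 -> alpha * mu = (1 - b) ^+ 2 ->
  (forall i, mu <= lam 0 i) -> (forall i, alpha * lam 0 i <= 1 + b ^+ 2) ->
  admissible_gain alpha (b ^+ 2) 0 (quadratic Q p r) xs (1 / Num.sqrt (2 * mu)).
Proof.
move=> QUlam Qpd xs_min mu0 a0 b0 b1 amu lam_ge lam_le.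
have [Qsym _] := Qpd; have xs_stat := minimizer_stationary Qpd xs_min.
pose c i := 1 + b ^+ 2 - alpha * lam 0 i.
have c_ge0 i : 0 <= c i by have := lam_le i; rewrite /c; lra.
have c_le i : c i <= 2 * b.
  by have := ler_wpM2l (ltW a0) (lam_ge i); rewrite amu /c; lra.
pose xi (x : 'cV[R]_d) i : R := (U^T *m (x - xs)) i 0.
pose K := 2 * mu * alpha ^+ 2.
have K_gt0 : 0 < K by rewrite !mulr_gt0// exprn_gt0.
exists (fun x => (\sum_i storage b (c i) (xi x i) (xi x i)) / K); split.
- move=> x; apply: divr_ge0; last exact: ltW.
  by apply: sumr_ge0 => i _; apply: storage_ge0.
- rewrite big1 ?mul0r// => i _.
  by rewrite /xi subrr mulmx0 mxE storage00.
move=> x0 w _; set f := quadratic Q p r.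
set s := gmm_state alpha (b ^+ 2) 0 f w x0.
pose X k i : R := xi (s k).1 i; pose Y k i : R := xi (s k).2 i.
pose W k i : R := (U^T *m w k) i 0.
have gap k : f (gmm alpha (b ^+ 2) 0 f w x0 k) - f xs = \sum_i lam 0 i / 2 * X k i ^+ 2.
  rewrite (quadratic_gap _ Qpd xs_min) (quadform_eigenbasis QUlam) mulr_sumr.
  by apply: eq_bigr => i _; rewrite mulrA [2^-1 * _]mulrC.
have wE k : sqnorm2 (w k) = \sum_i W k i ^+ 2.
  by rewrite -(sqnorm2_eigenbasis QUlam).
have step k i : storage b (c i) (X k.+1 i) (Y k.+1 i) - storage b (c i) (X k i) (Y k i)
    + alpha ^+ 2 * lam 0 i * mu * X k i ^+ 2 <= alpha ^+ 2 * W k i ^+ 2.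
  have [XE YE] := gmm_coordS r x0 alpha (b ^+ 2) 0 w k i QUlam Qsym xs_stat.
  have := storage_dissipation (X k.+1 i) (X k i) (Y k i) b0 (c_ge0 i) (c_le i).
  rewrite (_ : (1 + b ^+ 2 - c i) * (1 - b) ^+ 2 = alpha ^+ 2 * lam 0 i * mu); last first.
    by rewrite -amu /c; ring.
  have -> : X k.+1 i - c i * X k i + b ^+ 2 * Y k i = - alpha * W k i.
    by rewrite /X /xi XE /c /Y /W /X /xi; ring.
  have -> : Y k.+1 i = X k i by exact: YE.
  by rewrite exprMn sqrrN.
have partial n : \sum_(0 <= k < n) (f (gmm alpha (b ^+ 2) 0 f w x0 k) - f xs)
    + (\sum_i storage b (c i) (X n i) (Y n i)) / K
    <= (1 / Num.sqrt (2 * mu)) ^+ 2 * (\sum_(0 <= k < n) sqnorm2 (w k))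
      + (\sum_i storage b (c i) (xi x0 i) (xi x0 i)) / K.
  have mu2_ge0 : 0 <= 2 * mu by rewrite mulr_ge0// ltW.
  rewrite expr_div_n expr1n (sqr_sqrtr mu2_ge0).
  elim: n => [|n IH]; first by rewrite !big_nil mulr0 !add0r lexx.
  rewrite !big_nat_recr//= [X in _ <= X](_ : _ = 
     (1 / (2 * mu) * (\sum_(0 <= k < n) sqnorm2 (w k)) + 
     (\sum_i storage b (c i) (xi x0 i) (xi x0 i)) / K) + 1 / (2 * mu) * sqnorm2 (w n)); last by ring.
  move: IH; set Fn := \sum_(0 <= k < n) (_ - _); move=> IH.
  (* One step of the induction is [step], divided by [K] and summed over the
     eigenbasis. *)
  have h : (f (gmm alpha (b ^+ 2) 0 f w x0 n) - f xs)
      + (\sum_i storage b (c i) (X n.+1 i) (Y n.+1 i)) / K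
    <= (\sum_i storage b (c i) (X n i) (Y n i)) / K + 1 / (2 * mu) * sqnorm2 (w n).
    rewrite gap wE !mulr_suml mulr_sumr -!big_split /=.
    apply: ler_sum => i _; have Kinv_ge0 : 0 <= K^-1 by rewrite invr_ge0 ltW.
    have := ler_wpM2r Kinv_ge0 (step n i).
    have -> : alpha ^+ 2 * W n i ^+ 2 / K = 1 / (2 * mu) * W n i ^+ 2.
      by rewrite /K; field; rewrite !lt0r_neq0.
    have -> : (storage b (c i) (X n.+1 i) (Y n.+1 i) - storage b (c i) (X n i) (Y n i)
      + alpha ^+ 2 * lam 0 i * mu * X n i ^+ 2) / K
      = storage b (c i) (X n.+1 i) (Y n.+1 i) / K - storage b (c i) (X n i) (Y n i) / K
        + lam 0 i / 2 * X n i ^+ 2.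
      by rewrite /K; field; rewrite !lt0r_neq0.
    lra.
  by move: IH h; lra.
have gap_ge0 k : 0 <= f (gmm alpha (b ^+ 2) 0 f w x0 k) - f xs by rewrite subr_ge0.
apply: lime_le; first by apply: is_cvg_nneseries => k _ _; rewrite lee_fin.
apply: nearW => n; rewrite sumEFin.
have w_ge0 k : (0 <= (sqnorm2 (w k))%:E)%E.
  by rewrite lee_fin; apply: sumr_ge0 => i _; exact: sqr_ge0.
have Wn : ((\sum_(0 <= k < n) sqnorm2 (w k))%:E <= \sum_(0 <= k <oo) (sqnorm2 (w k))%:E)%E.
  by rewrite -sumEFin; apply: nneseries_lim_ge => k _ _.
have g2 : (0 <= ((1 / Num.sqrt (2 * mu)) ^+ 2)%:E)%E by rewrite lee_fin sqr_ge0.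
apply: le_trans (leeD (lee_wpmul2l g2 Wn) (lexx _)).
rewrite -EFinM -EFinD lee_fin; apply: le_trans (partial n).
rewrite lerDl; apply: divr_ge0; last exact: ltW.
by apply: sumr_ge0 => i _; apply: storage_ge0.
Qed.

(** * Lower bound on the l2 gain *)

(** The prescribed displacement: zero at the start, one at times [1..n], and
    zero afterwards. *)
Definition pulse (R : realType) (n k : nat) : R := (0 < k <= n)%N%:R.

Lemma sum_pulse (R : realType) (n m : nat) :
  \sum_(0 <= k < m.+1) pulse R n k = (minn m n)%:R.
Proof.
elim: m => [|m IH]; first by rewrite big_nat1 min0n.
rewrite big_nat_recr//= IH /pulse -natrD; congr _%:R.
case: (ltnP m n) => h /=.
  by rewrite (minn_idPl h) addn1.
by rewrite (minn_idPr (leqW h)) addn0.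
Qed.

Lemma sum_delta_le1 (R : realType) (j m : nat) :
  \sum_(0 <= k < m) (k == j)%:R <= 1 :> R.
Proof.
suff -> : \sum_(0 <= k < m) (k == j)%:R = (j < m)%N%:R :> R by case: (_ < _)%N.
elim: m => [|m IH]; first by rewrite big_nil.
rewrite big_nat_recr//= IH -natrD ltnS; congr _%:R.
by case: (ltngtP j m).
Qed.

(** The errors that make the method follow [pulse] along an eigenvector of
    eigenvalue [mu], obtained by solving the recursion for the error. At
    [k = 0] the truncated predecessor [k.-1 = 0] encodes [x_(-1) = x_0]. *)
Definition pulse_error (R : realType) (alpha beta nu mu : R) (n k : nat) : R :=
  let x := pulse R n in
  (x k + beta * (x k - x k.-1) - x k.+1) / alpha
    - mu * (x k + nu * (x k - x k.-1)).

Lemma gmm_pulse (R : realType) (d : nat) (Q : 'M[R]_d) (p : 'cV[R]_d) (r : R)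
    (xs v : 'cV[R]_d) (alpha beta nu mu : R) (n k : nat) :
  Q^T = Q -> Q *m xs + p = 0 -> alpha != 0 -> Q *m v = mu *: v ->
  gmm_state alpha beta nu (quadratic Q p r)
    (fun k => pulse_error alpha beta nu mu n k *: v) xs k
  = (xs + pulse R n k *: v, xs + pulse R n k.-1 *: v).
Proof.
move=> Qsym xs_stat a0 Qv; elim: k => [|k IH].
  by rewrite /= /pulse scale0r addr0.
set w := fun k => _; have [] := gmm_stateS r xs alpha beta nu w k Qsym xs_stat.
case: (gmm_state _ _ _ _ _ _ k.+1) => x y /=; rewrite -/w in IH; rewrite IH /=.
move=> E1 ->; congr (_, _); rewrite -(subrK xs x) E1.
set a := pulse R n k; set a' := pulse R n k.-1.
have -> : xs + a *: v - xs + nu *: (xs + a *: v - (xs + a' *: v))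
    = (a + nu * (a - a')) *: v by apply/colP => j; rewrite !mxE; ring.
rewrite -scalemxAr Qv /w /pulse_error -/a -/a'.
by apply/colP => j; rewrite !mxE; field.
Qed.

(** Where the pulse is constant on [k - 1, k, k + 1] the error is exactly
    [- mu] times it, i.e. it balances the gradient; only the four times next to
    the two jumps deviate, by an amount independent of [n]. *)
Lemma pulse_error_sqr (R : realType) (alpha beta nu mu : R) :
  exists2 C : R, 0 <= C & forall n k, pulse_error alpha beta nu mu n k ^+ 2
    <= mu ^+ 2 * pulse R n k
      + C * ((k == 0)%:R + (k == n)%:R + (k == 1)%:R + (k == n.+1)%:R).
Proof.
(* [A] and [B] are the weights of the forward and backward differences of the
   pulse in the error. *)
pose A := alpha^-1; pose B := beta / alpha - mu * nu.
exists ((`|mu| + `|A| + `|B|) ^+ 2) => [|n k]; first exact: sqr_ge0.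
have xE j : pulse R n j \in [:: 0; 1].
  by rewrite /pulse; case: (_ <= _ <= _)%N; rewrite !inE eqxx ?orbT.
have errE : pulse_error alpha beta nu mu n k = - mu * pulse R n k
    - A * (pulse R n k.+1 - pulse R n k) + B * (pulse R n k - pulse R n k.-1).
  by rewrite /pulse_error /A /B; ring.
have [edge|inner] := boolP [|| k == 0%N, k == n, k == 1%N | k == n.+1].
  have edge_ge1 : 1 <= (k == 0)%:R + (k == n)%:R + (k == 1)%:R + (k == n.+1)%:R :> R.
    by rewrite -!natrD ler1n; case/or4P: edge => ->; rewrite ?addnS.
  have err_le : `|pulse_error alpha beta nu mu n k| <= `|mu| + `|A| + `|B|.
    have h x y z : x \in [:: 0; 1] -> y \in [:: 0; 1] -> `|z * (x - y)| <= `|z| :> R.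
      rewrite !inE normrM => /orP[]/eqP-> /orP[]/eqP->.
      - by rewrite subrr normr0 mulr0.
      - by rewrite sub0r normrN normr1 mulr1.
      - by rewrite subr0 normr1 mulr1.
      - by rewrite subrr normr0 mulr0.
    rewrite errE; apply: le_trans (ler_normD _ _) _; apply: lerD; last exact: h.
    apply: le_trans (ler_normB _ _) _; apply: lerD; last exact: h.
    have := h (pulse R n k) 0 (- mu) (xE k); rewrite subr0 normrN; apply.
    by rewrite !inE eqxx.
  rewrite -ler_sqr ?nnegrE ?addr_ge0 ?normr_ge0// real_normK ?num_real// in err_le.
  have C_le := ler_wpM2l (sqr_ge0 (`|mu| + `|A| + `|B|)) edge_ge1.
  have x_ge0 : 0 <= mu ^+ 2 * pulse R n k by rewrite mulr_ge0 ?sqr_ge0 ?ler0n.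
  by rewrite mulr1 in C_le; move: err_le C_le x_ge0; lra.
move: inner; rewrite !negb_or => /and4P[k0 kn k1 kn1].
have xS : pulse R n k.+1 = pulse R n k.
  rewrite /pulse; congr (nat_of_bool _)%:R; lia.
have xP : pulse R n k.-1 = pulse R n k.
  rewrite /pulse; congr (nat_of_bool _)%:R; lia.
rewrite errE xS xP !subrr !mulr0 subr0 addr0 mulNr sqrrN exprMn.
rewrite (negPf k0) (negPf kn) (negPf k1) (negPf kn1) !addr0 mulr0 addr0.
by have := xE k; rewrite !inE => /orP[]/eqP->; rewrite ?expr0n ?expr1n.
Qed.

(** Starting at the minimizer leaves no initial term, so a gain [gamma] yields
    [mu n / 2 <= gamma ^ 2 (mu ^ 2 n + 4 C)] for every length [n] of the pulse,
    which forces [1 <= 2 mu gamma ^ 2]. *)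
Lemma gain_lower_bound (R : realType) (d : nat) (Q : 'M[R]_d)
    (p : 'cV[R]_d) (r : R) (xs : 'cV[R]_d) (alpha beta nu mu gamma : R) :
  sym_posdef Q -> minimizer (quadratic Q p r) xs -> eigenvalue Q mu -> 0 < mu ->
  alpha != 0 -> 0 < gamma ->
  admissible_gain alpha beta nu (quadratic Q p r) xs gamma ->
  1 / Num.sqrt (2 * mu) <= gamma.
Proof.
move=> Qpd xs_min /eigenvalueP[u uQ u_neq0] mu0 a0 g0 [H [_ Hxs adm]].
have [Qsym Qpos] := Qpd; have xs_stat := minimizer_stationary Qpd xs_min.
pose v := u^T; have Qv : Q *m v = mu *: v.
  by rewrite /v -[Q]Qsym -trmx_mul uQ linearZ.
have v_neq0 : v != 0 by apply: contra_neq u_neq0 => v0; rewrite -[u]trmxK -/v v0 trmx0.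
pose S := sqnorm2 v.
have sqnorm2Z c : sqnorm2 (c *: v) = c ^+ 2 * S.
  by rewrite /S /sqnorm2 mulr_sumr; apply: eq_bigr => i _; rewrite mxE exprMn.
have formE : (v^T *m Q *m v) 0 0 = mu * S.
  rewrite -mulmxA Qv -scalemxAr mxE; congr (_ * _); rewrite mxE.
  by apply: eq_bigr => i _; rewrite mxE expr2.
have S0 : 0 < S by have := Qpos v v_neq0; rewrite formE pmulr_rgt0.
have [C C0 errC] := pulse_error_sqr alpha beta nu mu.
(* Both sides are stated after division by the squared norm [S] of [v]. *)
have budget n : mu / 2 * n%:R <= gamma ^+ 2 * (mu ^+ 2 * n%:R + 4 * C).
  set f := quadratic Q p r in adm.
  pose w k := pulse_error alpha beta nu mu n k *: v.
  have w_ge0 k : (0 <= (sqnorm2 (w k))%:E)%E.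
    by rewrite lee_fin sqnorm2Z mulr_ge0 ?sqr_ge0// ltW.
  have w_sum : (\sum_(0 <= k <oo) (sqnorm2 (w k))%:E
      <= (S * (mu ^+ 2 * n%:R + 4 * C))%:E)%E.
    apply: lime_le; first by apply: is_cvg_nneseries => k _ _.
    apply: nearW => m; rewrite sumEFin lee_fin.
    under eq_bigr do rewrite sqnorm2Z mulrC.
    rewrite -mulr_sumr ler_wpM2l ?(ltW S0)//.
    apply: le_trans (ler_sum _ (fun k _ => errC n k)) _.
    rewrite big_split /= -!mulr_sumr !big_split /=; apply: lerD.
      rewrite ler_wpM2l ?sqr_ge0//; case: m => [|m]; first by rewrite big_nil.
      by rewrite sum_pulse ler_nat geq_minr.
    rewrite mulrC ler_wpM2r//.
    have -> : 4 = 1 + 1 + 1 + 1 :> R by ring.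
    by rewrite !lerD ?sum_delta_le1.
  have w_sq : square_summable w by apply: le_lt_trans w_sum _; exact: ltry.
  have gap k : f (gmm alpha beta nu f w xs k) - f xs = mu / 2 * S * pulse R n k.
    rewrite /gmm (gmm_pulse r beta nu n k Qsym xs_stat a0 Qv) /=.
    rewrite (quadratic_gap _ Qpd xs_min) [_ - xs]addrC addKr.
    have -> : (pulse R n k *: v)^T = pulse R n k *: v^T by rewrite linearZ.
    rewrite -!scalemxAl -scalemxAr scalerA mxE formE /pulse.
    by case: (_ <= _ <= _)%N; rewrite ?mulr0 ?mul0r ?mulr1 ?mul1r; ring.
  have := adm xs w w_sq; rewrite Hxs adde0 => total.
  have part : ((mu / 2 * S * n%:R)%:E
      <= \sum_(0 <= k <oo) (f (gmm alpha beta nu f w xs k) - f xs)%:E)%E.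
    apply: le_trans (nneseries_lim_ge n.+1 _); last first.
      by move=> k _ _; rewrite lee_fin subr_ge0.
    rewrite sumEFin lee_fin; under eq_bigr do rewrite gap.
    by rewrite -mulr_sumr sum_pulse minnn.
  have g2 : (0 <= (gamma ^+ 2)%:E)%E by rewrite lee_fin sqr_ge0.
  have := le_trans (le_trans part total) (lee_wpmul2l g2 w_sum).
  rewrite -EFinM lee_fin => h; rewrite -(ler_pM2l S0).
  by move: h; lra.
suff h : 1 <= gamma ^+ 2 * (2 * mu).
  have mu2_gt0 : 0 < 2 * mu by rewrite mulr_gt0.
  rewrite ler_pdivrMr ?sqrtr_gt0// -ler_sqr ?nnegrE ?mulr_ge0 ?sqrtr_ge0 ?(ltW g0)//.
  by rewrite expr1n exprMn sqr_sqrtr// ltW.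
rewrite leNgt; apply/negP => h.
pose e := mu / 2 - gamma ^+ 2 * mu ^+ 2.
have e0 : 0 < e.
  have -> : e = mu / 2 * (1 - gamma ^+ 2 * (2 * mu)) by rewrite /e; field.
  by rewrite mulr_gt0 ?subr_gt0// divr_gt0.
have bound_ge0 : 0 <= gamma ^+ 2 * (4 * C) / e.
  by rewrite divr_ge0 ?(ltW e0)// mulr_ge0 ?sqr_ge0// mulr_ge0.
have := archi_boundP bound_ge0; rewrite ltr_pdivrMr//; set n := Num.bound _.
by have := budget n; rewrite /e; lra.
Qed.

Lemma l2_gain_ge (R : realType) (d : nat) (Q : 'M[R]_d)
    (p : 'cV[R]_d) (r : R) (xs : 'cV[R]_d) (alpha beta nu mu : R) :
  sym_posdef Q -> minimizer (quadratic Q p r) xs -> eigenvalue Q mu -> 0 < mu ->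
  alpha != 0 ->
  ((1 / Num.sqrt (2 * mu))%:E <= l2_gain alpha beta nu (quadratic Q p r) xs)%E.
Proof.
move=> Qpd xs_min Qmu mu0 a0; apply: le_ereal_inf_tmp => _ [g [g0 adm] <-].
by rewrite lee_fin; exact: gain_lower_bound adm.
Qed.

(** * Heavy ball with the prescribed parameters *)

Lemma hb_parameters (R : realType) (mu L : R) : 0 < mu < L ->
  let b := 1 - hb_a (L / mu) / Num.sqrt (L / mu) in
  [/\ 0 < b < 1, 0 < hb_alpha mu L, hb_alpha mu L * mu = (1 - b) ^+ 2 &
      hb_alpha mu L * L <= 1 + b ^+ 2].
Proof.
move=> /andP[mu0 muL] b; have L0 : 0 < L by exact: lt_trans muL.
have kappa1 : 1 < L / mu by rewrite ltr_pdivlMr// mul1r.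
have [a0 ak1 a2_le] := hb_a_bounds kappa1.
have k0 : 0 < Num.sqrt (L / mu) by rewrite sqrtr_gt0 divr_gt0.
split.
- have ak0 : 0 < hb_a (L / mu) / Num.sqrt (L / mu) by rewrite divr_gt0.
  by rewrite /b; apply/andP; split; lra.
- by rewrite /hb_alpha divr_gt0// exprn_gt0.
- have -> : 1 - b = hb_a (L / mu) / Num.sqrt (L / mu) by rewrite /b; ring.
  rewrite expr_div_n (sqr_sqrtr (ltW (divr_gt0 L0 mu0))) /hb_alpha.
  by field; rewrite !lt0r_neq0.
- by rewrite /hb_alpha divfK// lt0r_neq0.
Qed.

Lemma hb_rate (R : realType) (d : nat) (Q : 'M[R]_d) (mu L : R) :
  sym_posdef Q -> smallest_eigenvalue Q mu -> largest_eigenvalue Q L ->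
  0 < mu < L ->
  spectral_radius (A_mx Q (hb_alpha mu L) (hb_beta mu L) 0)
    = 1 - hb_a (L / mu) / Num.sqrt (L / mu).
Proof.
move=> [Qsym _] Qmu QL muL.
have [/andP[b0 b1] a0 amu aL] := hb_parameters muL.
apply: (spectral_radius_heavy_ball Qsym Qmu QL a0 b0 amu).
by apply: le_trans aL _; lra.
Qed.

Theorem proposition4p3 (R : realType) :
  (forall (d : nat) (Q : 'M[R]_d) (p : 'cV[R]_d) (r : R)
      (U : 'M[R]_d) (lam : 'rV[R]_d) (mu L : R) (xs : 'cV[R]_d),
    sym_posdef Q ->
    smallest_eigenvalue Q mu -> largest_eigenvalue Q L -> 0 < mu < L ->
    orthogonal_eigendecomposition Q U lam ->
    minimizer (quadratic Q p r) xs ->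
    let kappa := L / mu in
    let alpha := hb_alpha mu L in
    let beta := hb_beta mu L in
    let nu := 0 in
    [/\ spectral_radius (A_mx Q alpha beta nu)
          = 1 - hb_a kappa / Num.sqrt kappa,
        l2_gain alpha beta nu (quadratic Q p r) xs
          = (hinf_norm Q U lam alpha beta nu)%:E,
        hinf_norm Q U lam alpha beta nu = 1 / Num.sqrt (2 * mu),
        (exists2 z : R[i], ComplexField.Normc.normc z = 1 &
           spectral_norm (transfer_mx Q U lam alpha beta nu z)
             = hinf_norm Q U lam alpha beta nu) &
        (forall alpha' beta' nu' : R,
           spectral_radius (A_mx Q alpha' beta' nu') < 1 ->
           (l2_gain alpha beta nu (quadratic Q p r) xs
              <= l2_gain alpha' beta' nu' (quadratic Q p r) xs)%E)])
  /\
  (forall kappa1 kappa2 : R, 1 < kappa1 -> kappa1 <= kappa2 ->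
     hb_a kappa1 <= hb_a kappa2)
  /\
  (forall kappa : R, 32 <= kappa -> 5 / 4 < hb_a kappa)
  /\
  (exists C : R, \forall kappa \near +oo,
     `|hb_a kappa - (Num.sqrt 2 - 1 / Num.sqrt kappa)| <= C * (1 / kappa))
  /\
  (exists C : R, \forall kappa \near +oo,
     forall (d : nat) (Q : 'M[R]_d) (mu L : R),
       sym_posdef Q ->
       smallest_eigenvalue Q mu -> largest_eigenvalue Q L -> 0 < mu < L ->
       L / mu = kappa ->
       `|spectral_radius (A_mx Q (hb_alpha mu L) (hb_beta mu L) 0)
          - (1 - Num.sqrt 2 / Num.sqrt kappa)| <= C * (1 / kappa)).
Proof.
split; [|split; [|split; [|split]]].
- move=> d Q p r U lam mu L xs Qpd Qmu QL muL QUlam xs_min kappa alpha beta nu.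
  have rate : spectral_radius (A_mx Q alpha beta nu) = 1 - hb_a kappa / Num.sqrt kappa.
    exact: hb_rate.
  pose b := 1 - hb_a kappa / Num.sqrt kappa.
  have [/andP[b0 b1] a0 amu aL] : [/\ 0 < b < 1, 0 < alpha,
    alpha * mu = (1 - b) ^+ 2 & alpha * L <= 1 + b ^+ 2] by exact: hb_parameters.
  have /andP[mu0 _] := muL.
  have [Qmu_eig mu_min] := Qmu; have [_ L_max] := QL.
  have [i0 /esym lam_i0] := eigenvalue_lamP QUlam Qmu_eig.
  have lam_ge i : mu <= lam 0 i by exact: mu_min (eigenvalue_lam QUlam i).
  have lam_le i : alpha * lam 0 i <= 1 + b ^+ 2.
    apply: le_trans aL; apply: ler_wpM2l; first exact: ltW.
    exact: L_max (eigenvalue_lam QUlam i).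
  have z_reg z : normc z = 1 -> ~~ eigenvalue (complexmx (A_mx Q alpha (b ^+ 2) 0)) z.
    move=> z1; apply/negP => /spectral_radius_ge; rewrite z1.
    by move: rate; rewrite /beta /nu /hb_beta => ->; rewrite -/b; lra.
  have [hinf at1] := hinf_heavy_ball QUlam mu0 a0 b0 amu lam_i0 lam_ge lam_le z_reg.
  have g0 : 0 < 1 / Num.sqrt (2 * mu) by rewrite divr_gt0// sqrtr_gt0 mulr_gt0.
  have gain : l2_gain alpha beta nu (quadratic Q p r) xs = (1 / Num.sqrt (2 * mu))%:E.
    apply/eqP; rewrite eq_le; apply/andP; split; last first.
      exact: (l2_gain_ge _ _ Qpd xs_min Qmu_eig mu0 (lt0r_neq0 a0)).
    apply: ereal_inf_lbound; exists (1 / Num.sqrt (2 * mu)) => //; split=> //.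
    exact: (heavy_ball_admissible QUlam Qpd xs_min mu0 a0 b0 b1 amu lam_ge lam_le).
  split.
  + exact: rate.
  + by rewrite gain; congr (_%:E); rewrite -hinf.
  + exact: hinf.
  + exists 1; first exact: normc1.
    by rewrite [RHS]hinf -at1.
  + move=> alpha' beta' nu' stable; rewrite gain.
    apply: (l2_gain_ge _ _ Qpd xs_min Qmu_eig mu0).
    exact: (stable_step_neq0 Qmu_eig stable).
- exact: hb_a_nondecreasing.
- exact: hb_a_gt.
- exists 3; near=> kappa; apply: hb_a_expansion.
  by near: kappa; apply: nbhs_pinfty_ge; rewrite num_real.
- exists 4; near=> kappa => d Q mu L Qpd Qmu QL muL kappaE.
  rewrite (hb_rate Qpd Qmu QL muL) kappaE; apply: hb_rate_expansion.
  by near: kappa; apply: nbhs_pinfty_ge; rewrite num_real.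
Unshelve. all: by end_near. Qed.
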